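(* Consider the triangular simultaneous equations model and fitted regressor matrix $\hat X$ described in the context. Let $K=J(\beta^* )$, $\Sigma_{K^cK}=\mathbb{E}[X^{*T}_{1,K^c}X^*_{1,K}]$ and $\Sigma_{KK}=\mathbb{E}[X^{*T}_{1,K}X^*_{1,K}]$. Suppose $\|\Sigma_{K^cK}\Sigma_{KK}^{-1}\|_\infty\le1-\phi$ for some $\phi\in(0,1]$ and $\lambda_{\min}(\Sigma_{KK})\ge C_{\min}>0$. Suppose also: (A) the data $\{y_i,\mathbf{x}_i,\mathbf{z}_i\}_{i=1}^n$ are i.i.d. with finite second moments, $\mathbb{E}(\mathbf{z}_{ij}\epsilon_i)=\mathbb{E}(\mathbf{z}_{ij}\eta_{ij})=\mathbf{0}$ for all $j$, and $\mathbb{E}(\mathbf{z}_{ij}\eta_{ij'})=\mathbf{0}$ for all $j\neq j'$; $p$ and $d$ can grow with and exceed $n$; each $\pi_j^*$ has at most $k_1$ and $\beta^*$ at most $k_2$ non-zero components, where $k_1,k_2$ can increase to infinity with $n$ but slowly compared to $n$; $\epsilon$ and $\eta_j$ are i.i.d. zero-mean sub-Gaussian vectors with parameters $\sigma_\epsilon^2$ and $\sigma_\eta^2$, and $Z_j$ is a sub-Gaussian matrix with parameters $(\Sigma_{Z_j},\sigma_Z^2)$ for each $j$; $X^*$ is a sub-Gaussian matrix with parameters $(\Sigma_{X^*},\sigma_{X^*}^2)$. (i) Suppose that $\max_{j}|\hat\pi_j-\pi_j^*|_1\le \frac{c\sigma_\eta}{\lambda_{\min}(\Sigma_Z)}k_1\sqrt{\frac{\log\max(d,p)}{n}}$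 with probability at least $1-c_1\exp(-c_2\log\max(d,p,n))$ for some universal constants $c,c_1,c_2$. Then under the condition $$\frac1n\max\left\{k_1k_2^{3/2}\log p,\ k_2^3\log p\right\}=O(1),\qquad\frac1nk_1^2k_2^2\log\max(p,d)=o(1),$$ we have $$\mathbb{P}\left[\left\|\frac1n\hat X_{K^c}^T\hat X_K\left(\frac1n\hat X_K^T\hat X_K\right)^{-1}\right\|_\infty\ge1-\frac\phi4\right]\le O\left(\frac1{\min(p,d)}\right).$$ (ii) Suppose that: for $v_j\in\mathbb{K}(k_1,d_j)$, $j=1,\dots,p$, the matrix $W\in\mathbb{R}^{n\times p}$ with $j$th column $Z_jv_j$ is sub-Gaussian with parameters $(\Sigma_W,\sigma_W^2)$; $\max_{j}|\hat\pi_j-\pi_j^*|_2\le \frac{c\sigma_\eta}{\lambda_{\min}(\Sigma_Z)}\sqrt{\frac{k_1\log\max(d,p)}{n}}$ with probability at least $1-c_1\exp(-c_2\log\max(d,p,n))$; and $J(\hat\pi_j)=J(\pi_j^* )$ for every $j$ with probability at least $1-c_1\exp(-c_2\log\max(d,p,n))$ (universal constants $c,c_1,c_2$). Then under the condition $$\frac1n\max\left\{k_1^{1/2}k_2^{3/2}\log p,\ k_2^3\log p\right\}=O(1),$$ $$\frac1n\min\left\{k_1^2k_2^2\log\max(p,d),\ \min_{r\in[0,1]}\max\left\{k_1^{3-2r}\log d,\ k_1^{3-2r}\log p,\ k_1^rk_2\log d,\ k_1^rk_2\log p\right\}\right\}=o(1),$$ $$\frac1nk_1k_2^2\log\max(p,d)=o(1),$$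 we have $$\mathbb{P}\left[\left\|\frac1n\hat X_{K^c}^T\hat X_K\left(\frac1n\hat X_K^T\hat X_K\right)^{-1}\right\|_\infty\ge1-\frac\phi4\right]\le O\left(\frac1{\min(p,d)}\right).$$
   Context: Notation: $|v|_q$ is the $l_q$ norm of a vector; $|v|_0$ is the number of non-zero entries; $J(v)=\{j:v_j\ne0\}$; $K^c$ is the complement of $K$ in $\{1,\dots,p\}$. $\mathbb{K}(s,m)=\{v\in\mathbb{R}^m:|v|_0\le s,\ |v|_2\le1\}$. For a matrix $A$, $\|A\|_\infty=\max_i\sum_j|a_{ij}|$. $\lambda_{\min}$ is the minimum eigenvalue. $O$ and $o$ are as $n\to\infty$. For an index set $S$, $\hat X_S$ is the submatrix of columns of $\hat X$ indexed by $S$, and $X^*_{1,S}$ is the row vector of entries of the first row of $X^*$ with column indices in $S$. Sub-Gaussian: a random variable $U$ with mean $\mu$ is sub-Gaussian with parameter $\sigma^2$ if $\mathbb{E}[\exp(t(U-\mu))]\le\exp(\sigma^2t^2/2)$ for all $t\in\mathbb{R}$. A random matrix $A\in\mathbb{R}^{n\times m}$ is sub-Gaussian with parameters $(\Sigma_A,\sigma_A^2)$ if its rows are sampled independently from a zero-mean distribution on $\mathbb{R}^m$ with covariance $\Sigma_A$ and, for any unit vector $u\in\mathbb{R}^m$, the inner product of $u$ with each row is sub-Gaussian with parameter at most $\sigma_A^2$. Model: for $i=1,\dots,n$, $y_i=\mathbf{x}_i^T\beta^*+\epsilon_i$ with $\mathbf{x}_i,\beta^*\in\mathbb{R}^p$,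 and $x_{ij}=\mathbf{z}_{ij}^T\pi_j^*+\eta_{ij}$ for $j=1,\dots,p$ with $\mathbf{z}_{ij},\pi_j^*\in\mathbb{R}^{d_j}$; $\epsilon_i,\eta_{ij}$ are zero-mean errors; $\mathbf{z}_i$ collects $\mathbf{z}_{i1},\dots,\mathbf{z}_{ip}$. Stack: $\epsilon\in\mathbb{R}^n$; $\eta_j=(\eta_{1j},\dots,\eta_{nj})^T$; $Z_j\in\mathbb{R}^{n\times d_j}$ has rows $\mathbf{z}_{ij}^T$. $X^*\in\mathbb{R}^{n\times p}$ has $j$th column $Z_j\pi_j^*$. Given first-stage estimates $\hat\pi_j$ of $\pi_j^*$, $\hat X\in\mathbb{R}^{n\times p}$ has columns $\hat{\mathbf{x}}_j=Z_j\hat\pi_j$. $\lambda_{\min}(\Sigma_Z)=\min_j\lambda_{\min}(\Sigma_{Z_j})$. Standing conventions: $(y_i,\mathbf{x}_i,\mathbf{z}_i)$ have mean zero; $d_j=d$ for all $j$; $p\ge n$ and $d\ge n$.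
   Formalization: The universal constant c_2 is taken to be at least 1 (for c_2 < 1 the O(1/min(p,d)) bound can fail), and λ_min(Σ_Z) is assumed bounded below by a fixed positive constant independent of n, since otherwise the first-stage rate does not control π̂. *)

(* Defs.v *)
From HB Require Import structures.
From mathcomp Require Import all_boot all_order all_algebra.
From mathcomp Require Import all_classical all_reals all_analysis.
Import Order.TTheory GRing.Theory Num.Theory.
Import numFieldNormedType.Exports.

Set Implicit Arguments.
Unset Strict Implicit.
Unset Printing Implicit Defensive.

Local Open Scope classical_set_scope.
Local Open Scope ring_scope.

(** * Vectors and matrices *)

Definition l1norm (R : realType) (m : nat) (v : 'cV[R]_m) : R :=
  \sum_(j < m) `|v j 0|.

Definition l2norm (R : realType) (m : nat) (v : 'cV[R]_m) : R :=
  Num.sqrt (\sum_(j < m) v j 0 ^+ 2).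

Definition J (R : realType) (m : nat) (v : 'cV[R]_m) : {set 'I_m} :=
  [set j | v j 0 != 0]%SET.

Definition l0norm (R : realType) (m : nat) (v : 'cV[R]_m) : nat := #|J v|.

Definition sparse_ball (R : realType) (s m : nat) : set 'cV[R]_m :=
  [set v | (l0norm v <= s)%N /\ l2norm v <= 1].

Definition infnorm_mx (R : realType) (m k : nat) (A : 'M[R]_(m, k)) : R :=
  \big[Num.max/0]_(i < m) \sum_(j < k) `|A i j|.

(* Extended-real valued: the minimum eigenvalue of an empty matrix is +oo. *)
Definition lambda_min (R : realType) (m : nat) (A : 'M[R]_m) : \bar R :=
  ereal_inf [set a%:E | a in [set a : R | eigenvalue A a]].

Definition cols (R : realType) (n m : nat) (A : 'M[R]_(n, m))
    (S : {set 'I_m}) : 'M[R]_(n, #|S|) :=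
  colsub (fun a : 'I_#|S| => enum_val a) A.

(* The matrix whose j-th column is Z_j v_j. *)
Definition stack_cols (R : realType) (n p d : nat)
    (Z : 'I_p -> 'M[R]_(n, d)) (v : 'I_p -> 'cV[R]_d) : 'M[R]_(n, p) :=
  \matrix_(i, j) (Z j *m v j) i 0.

(** * Independence and sub-Gaussianity *)

(* The product sigma-algebra on C -> R, generated by the coordinate maps. *)
Definition vec_measurable (R : realType) (C : Type) : set (set (C -> R)) :=
  <<s [set (fun f : C -> R => f c) @^-1` B
        | c in [set: C] & B in @measurable _ R] >>.

Definition independent_vectors (R : realType) (disp : measure_display)
    (T : measurableType disp) (P : probability T R) (n : nat) (C : Type)
    (X : 'I_n -> T -> C -> R) : Prop :=
  forall B : 'I_n -> set (C -> R), (forall i, vec_measurable (B i)) ->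
    P (\bigcap_(i in [set: 'I_n]) (X i @^-1` B i)) =
    (\prod_(i < n) P (X i @^-1` B i))%E.

Definition identically_distributed (R : realType) (disp : measure_display)
    (T : measurableType disp) (P : probability T R) (n : nat) (C : Type)
    (X : 'I_n -> T -> C -> R) : Prop :=
  forall (i i' : 'I_n) (B : set (C -> R)), vec_measurable B ->
    P (X i @^-1` B) = P (X i' @^-1` B).

Definition iid (R : realType) (disp : measure_display)
    (T : measurableType disp) (P : probability T R) (n : nat) (C : Type)
    (X : 'I_n -> T -> C -> R) : Prop :=
  independent_vectors P X /\ identically_distributed P X.

Definition sub_gaussian (R : realType) (disp : measure_display)
    (T : measurableType disp) (P : probability T R) (U : T -> R) (s2 : R)
    : Prop :=
  U \in Lfun P 1 /\
  forall t : R,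
    ('E_P[fun w => expR (t * (U w - fine 'E_P[U]))%R]
       <= (expR (s2 * t ^+ 2 / 2))%:E)%E.

Definition sub_gaussian_mx (R : realType) (disp : measure_display)
    (T : measurableType disp) (P : probability T R) (n m : nat)
    (A : T -> 'M[R]_(n, m)) (Sigma : 'M[R]_m) (s2 : R) : Prop :=
  [/\ iid P (fun (i : 'I_n) w (j : 'I_m) => A w i j),
      (forall i j, 'E_P[fun w => A w i j] = 0)%E,
      (forall i j k,
         covariance P (fun w => A w i j) (fun w => A w i k) = (Sigma j k)%:E)
    & forall u : 'cV[R]_m, l2norm u = 1 -> forall i : 'I_n,
        exists2 s2', s2' <= s2 & sub_gaussian P (fun w => (A w *m u) i 0) s2'].

Definition iid_sub_gaussian_vec (R : realType) (disp : measure_display)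
    (T : measurableType disp) (P : probability T R) (n : nat)
    (e : 'I_n -> T -> R) (s2 : R) : Prop :=
  [/\ iid P (fun (i : 'I_n) w (_ : unit) => e i w),
      (forall i, 'E_P[e i] = 0)%E
    & forall i, sub_gaussian P (e i) s2].

(** * The triangular simultaneous equations model *)

Record tsem (R : realType) (disp : measure_display) (T : measurableType disp)
    (P : probability T R) (n p d : nat) := Tsem {
  y : 'I_n -> {RV P >-> R};
  x : 'I_n -> 'I_p -> {RV P >-> R};
  z : 'I_n -> 'I_p -> 'I_d -> {RV P >-> R};
  eps : 'I_n -> {RV P >-> R};
  eta : 'I_n -> 'I_p -> {RV P >-> R};
  betastar : 'cV[R]_p;
  pistar : 'I_p -> 'cV[R]_d;
  y_eq : forall i w, y i w = \sum_(j < p) x i j w * betastar j 0 + eps i w;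
  x_eq : forall i j w,
    x i j w = \sum_(l < d) z i j l w * pistar j l 0 + eta i j w
}.

Definition Zmx (R : realType) (disp : measure_display)
    (T : measurableType disp) (P : probability T R) (n p d : nat)
    (M : tsem P n p d) (w : T) (j : 'I_p) : 'M[R]_(n, d) :=
  \matrix_(i, l) z M i j l w.

Definition Xstar (R : realType) (disp : measure_display)
    (T : measurableType disp) (P : probability T R) (n p d : nat)
    (M : tsem P n p d) (w : T) : 'M[R]_(n, p) :=
  stack_cols (Zmx M w) (pistar M).

Definition pihat_vec (R : realType) (disp : measure_display)
    (T : measurableType disp) (P : probability T R) (p d : nat)
    (pihat : 'I_p -> 'I_d -> {RV P >-> R}) (w : T) (j : 'I_p) : 'cV[R]_d :=
  \col_l pihat j l w.

Definition Xhat (R : realType) (disp : measure_display)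
    (T : measurableType disp) (P : probability T R) (n p d : nat)
    (M : tsem P n p d) (pihat : 'I_p -> 'I_d -> {RV P >-> R}) (w : T)
    : 'M[R]_(n, p) :=
  stack_cols (Zmx M w) (pihat_vec pihat w).

Inductive data_coord (p d : nat) : Type :=
| Cy : data_coord p d
| Cx : 'I_p -> data_coord p d
| Cz : 'I_p -> 'I_d -> data_coord p d.

Definition data_row (R : realType) (disp : measure_display)
    (T : measurableType disp) (P : probability T R) (n p d : nat)
    (M : tsem P n p d) (i : 'I_n) (w : T) (c : data_coord p d) : R :=
  match c with
  | Cy => y M i w
  | Cx j => x M i j w
  | Cz j l => z M i j l w
  end.

Record assumption_A (R : realType) (disp : measure_display)
    (T : measurableType disp) (P : probability T R) (n p d : nat)
    (M : tsem P n p d) (k1 k2 : nat)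
    (SigmaZ : 'I_p -> 'M[R]_d) (SigmaX : 'M[R]_p)
    (sigma_eps sigma_eta sigma_Z sigma_X : R) : Prop := {
  A_iid : iid P (data_row M);
  A_L2 : [/\ forall i, (y M i : T -> R) \in Lfun P 2%:E,
             forall i j, (x M i j : T -> R) \in Lfun P 2%:E
           & forall i j l, (z M i j l : T -> R) \in Lfun P 2%:E];
  A_mean : [/\ forall i, ('E_P[y M i] = 0)%E,
               forall i j, ('E_P[x M i j] = 0)%E
             & forall i j l, ('E_P[z M i j l] = 0)%E];
  A_z_eps : forall i j l, ('E_P[fun w => (z M i j l w * eps M i w)%R] = 0)%E;
  A_z_eta : forall i j l, ('E_P[fun w => (z M i j l w * eta M i j w)%R] = 0)%E;
  A_z_eta' : forall i j j' l, j != j' ->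
    ('E_P[fun w => (z M i j l w * eta M i j' w)%R] = 0)%E;
  A_pi_sparse : forall j, (l0norm (pistar M j) <= k1)%N;
  A_beta_sparse : (l0norm (betastar M) <= k2)%N;
  A_eps : iid_sub_gaussian_vec P (fun i => eps M i) (sigma_eps ^+ 2);
  A_eta : forall j, iid_sub_gaussian_vec P (fun i => eta M i j) (sigma_eta ^+ 2);
  A_Z : forall j,
    sub_gaussian_mx P (fun w => Zmx M w j) (SigmaZ j) (sigma_Z ^+ 2);
  A_X : sub_gaussian_mx P (Xstar M) SigmaX (sigma_X ^+ 2)
}.

(* E[X*_{1,S}^T X*_{1,S'}]; the index i of the row is meant to be the first. *)
Definition Sigma_sub (R : realType) (disp : measure_display)
    (T : measurableType disp) (P : probability T R) (n p d : nat)
    (M : tsem P n p d) (i : 'I_n) (S S' : {set 'I_p}) : 'M[R]_(#|S|, #|S'|) :=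
  \matrix_(a, b) fine ('E_P[fun w =>
    ((cols (row i (Xstar M w)) S)^T *m cols (row i (Xstar M w)) S')%R a b])%E.

Definition gram_sub (R : realType) (n p : nat) (A : 'M[R]_(n, p))
    (S S' : {set 'I_p}) : 'M[R]_(#|S|, #|S'|) :=
  n%:R^-1 *: ((cols A S)^T *m cols A S').

(* invmx is the identity on singular matrices, so that singularity of the
   sample Gram matrix, where the displayed norm is undefined, is explicitly
   counted as part of the bad event. *)
Definition incoherence_failure (R : realType) (disp : measure_display)
    (T : measurableType disp) (P : probability T R) (n p d : nat)
    (M : tsem P n p d) (pihat : 'I_p -> 'I_d -> {RV P >-> R}) (phi : R)
    : set T :=
  let K := J (betastar M) in
  [set w | gram_sub (Xhat M pihat w) K K \notin unitmx \/
     1 - phi / 4 <=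
       infnorm_mx (gram_sub (Xhat M pihat w) (~: K)%SET K
                   *m invmx (gram_sub (Xhat M pihat w) K K))].

(** * First-stage estimation *)

Definition lambda_min_family (R : realType) (p d : nat)
    (S : 'I_p -> 'M[R]_d) : \bar R :=
  ereal_inf [set lambda_min (S j) | j in [set: 'I_p]].

Definition max_error (R : realType) (disp : measure_display)
    (T : measurableType disp) (P : probability T R) (n p d : nat)
    (M : tsem P n p d) (pihat : 'I_p -> 'I_d -> {RV P >-> R})
    (norm : 'cV[R]_d -> R) (w : T) : R :=
  \big[Num.max/0]_(j < p) norm (pihat_vec pihat w j - pistar M j).

Definition same_support (R : realType) (disp : measure_display)
    (T : measurableType disp) (P : probability T R) (n p d : nat)
    (M : tsem P n p d) (pihat : 'I_p -> 'I_d -> {RV P >-> R}) : set T :=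
  [set w | forall j, J (pihat_vec pihat w j) = J (pistar M j)].

Definition high_probability (R : realType) (disp : measure_display)
    (T : measurableType disp) (P : probability T R) (n p d : nat)
    (c1 c2 : R) (E : set T) : Prop :=
  ((1 - c1 * expR (- (c2 * ln (maxn (maxn d p) n)%:R)))%:E <= P E)%E.

(* Main.v *)
Require Import Defs.
From HB Require Import structures.
From mathcomp Require Import all_boot all_order all_algebra.
From mathcomp Require Import all_classical all_reals all_analysis.
From mathcomp Require Import measurable_realfun ring lra.
Import Order.TTheory GRing.Theory Num.Theory.
Import numFieldNormedType.Exports.

Set Implicit Arguments.
Unset Strict Implicit.
Unset Printing Implicit Defensive.

Local Open Scope classical_set_scope.
Local Open Scope ring_scope.

(** Write [q] for the size of the support [K] of [betastar] and [L] for
[ln (maxn p d)].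

The incoherence condition is stable under entrywise perturbations of size
[Cmin * phi / (8 q)] of the Gram matrix ([incoherence_stable]).  With
[theta = Sigma_CK Sigma_KK^-1], the difference between the sample regression
coefficients and [theta] is [(G_CK - theta G_KK) G_KK^-1]; since [theta
Sigma_KK = Sigma_CK] the bracket only involves deviations of [G] from [Sigma],
and since [G_KK] stays coercive ([rayleigh_perturb], which rests on the
variational characterisation [lambda_min_rayleigh]) its inverse costs at most a
factor [2 q / Cmin] from entrywise to row-l1 norm.

The entries of the Gram matrix of [Xhat] deviate for two reasons.

- Sampling.  Products of sub-Gaussian variables have a sub-exponential
  moment generating function near [0] ([expsq_mul_mgf_le]), so the entries of
  the Gram matrix of [X*] satisfy Bernstein's inequality
  ([expsq_sum_mul_tail]).  A union bound over the [p ^+ 2] entries at level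
  [tau / q] costs [p ^+ 2 * expR (- const * n / q ^+ 2)], which is at most
  [1 / maxn p d] as soon as [q ^+ 2 * L / n] is small.

- First-stage estimation.  If all columns of [Xhat - X*] have squared norm at
  most [n * del ^+ 2], Gram entries move by a multiple of [del] ([gram_shift]),
  so [q * del] has to be small.  Column [j] of [Xhat - X*] is [Z_j v] with [v]
  the estimation error of [pistar j].  In part (i) it is bounded by [`|v|_1]
  times the largest column norm of [Z_j] ([sqnorm_mul_l1_le]), so [del] is of
  order [k1 * sqrt (L / n)].  In part (ii) [v] lives on the support of
  [pistar j], which is not random, and a sub-Gaussian matrix is bounded on all
  vectors of that support at once: it is enough to control a deterministic grid
  of at most [(2 k1 + 1) ^ k1] points and the columns
  ([sqnorm_mul_sparse_le]).  The cost is a probability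
  [expR (O(k1 L) - n)], and [del] is of order [sqrt (k1 * L / n)].

In both parts the vanishing of [q ^+ 2 * del ^+ 2] is the rate condition, with
[k1 ^+ 2 * k2 ^+ 2 * L / n] respectively [k1 * k2 ^+ 2 * L / n]; as [k1] and
[q] are at least [1], the same quantity controls [q ^+ 2 * L / n] and
[k1 * L / n].  The degenerate cases are [q = 0], when failure is impossible, and
[k1 = 0], when [X* = 0] and the eigenvalue condition forces [q = 0]. *)


(** * Quadratic forms and the smallest eigenvalue *)

Definition sqnorm (R : realType) (I : finType) (a : I -> R) : R :=
  \sum_i a i ^+ 2.

Lemma sqnorm_ge0 (R : realType) (I : finType) (a : I -> R) : 0 <= sqnorm a.
Proof. by apply: sumr_ge0 => i _; exact: sqr_ge0. Qed.

Lemma sqnorm_eq0 (R : realType) (I : finType) (a : I -> R) :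
  sqnorm a = 0 -> forall i, a i = 0.
Proof.
move=> /eqP; rewrite psumr_eq0 => [/allP a0 i|i _]; last exact: sqr_ge0.
by have := a0 i (mem_index_enum i); rewrite /= sqrf_eq0 => /eqP.
Qed.

Lemma sqnorm_rowE (R : realType) m (u : 'rV[R]_m) :
  sqnorm (u 0) = (u *m u^T) 0 0.
Proof. by rewrite mxE; apply: eq_bigr => j _; rewrite mxE expr2. Qed.

Lemma quad_linear_min (R : realType) (b c : R) :
  (forall t, 0 <= t * b *+ 2 + t ^+ 2 * c) -> b = 0.
Proof.
move=> h; apply/eqP/negPn/negP => b0.
have c0 : 0 < `|c| + 1 by rewrite ltr_wpDl.
(* Near [0] the linear term dominates; this [t] is small enough for that. *)
have := h (- b / (`|c| + 1)).
have -> : (- b / (`|c| + 1)) * b *+ 2 + (- b / (`|c| + 1)) ^+ 2 * c =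
  (b / (`|c| + 1)) ^+ 2 * (c - (`|c| + 1) *+ 2).
  by field; rewrite gt_eqF.
have b2 : 0 < (b / (`|c| + 1)) ^+ 2.
  by rewrite exprn_even_gt0 //= mulf_neq0 // invr_eq0 gt_eqF.
rewrite pmulr_rge0 // subr_ge0 => hc.
have := ler_norm c; have := normr_ge0 c; lra.
Qed.

Lemma continuous_quad (R : realType) m (A : 'M[R]_m.+1) :
  continuous (fun u : 'rV[R]_m.+1 => (u *m A *m u^T) 0 0).
Proof.
have -> : (fun u : 'rV[R]_m.+1 => (u *m A *m u^T) 0 0) =
    (fun u : 'rV[R]_m.+1 => \sum_j (\sum_i u 0 i * A i j) * u 0 j).
  by apply/funext => u; rewrite mxE; apply: eq_bigr => j _; rewrite !mxE.
apply: continuous_big => [|j _]; first exact: add_continuous.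
move=> u; apply: continuousM; last exact: coord_continuous.
apply: continuous_big => [|i _ v]; first exact: add_continuous.
by apply: continuousM; [exact: coord_continuous|exact: cst_continuous].
Qed.

(** The Rayleigh quotient attains its minimum on the unit sphere, which is
compact, and a minimiser is an eigenvector because the quotient is stationary
there.  Hence a lower bound on the eigenvalues is one on the quadratic form. *)
Lemma lambda_min_rayleigh (R : realType) m (A : 'M[R]_m) (c : R) :
  A^T = A -> (c%:E <= lambda_min A)%E ->
  forall u : 'rV[R]_m, c * sqnorm (u 0) <= (u *m A *m u^T) 0 0.
Proof.
case: m A => [|m] A symA hc u.
  by rewrite /sqnorm big_ord0 mulr0 mxE big_ord0.
pose S : set 'rV[R]_m.+1 := [set v | (v *m 1%:M *m v^T) 0 0 = 1].
have SE v : S v <-> sqnorm (v 0) = 1.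
  by rewrite /S /= mulmx1 sqnorm_rowE.
have S0 : S !=set0.
  exists (delta_mx 0 0); apply/SE; rewrite /sqnorm (bigD1 ord0) //= big1 => [|j j0].
    by rewrite mxE !eqxx /= addr0 expr1n.
  by rewrite mxE (negbTE j0) andbF expr0n.
have cS : compact S.
  apply: bounded_closed_compact.
    exists 1; split; first exact: num_real.
    move=> M M1 v /SE v1; rewrite /= [leLHS]/Num.Def.normr /= mx_normrE.
    apply: bigmax_le => [|[i j] _ /=]; first by apply: le_trans (ltW M1).
    apply: le_trans (ltW M1); rewrite -(ler_pXn2r (n := 2)) ?nnegrE //.
    rewrite expr1n real_normK ?num_real // -v1 (ord1 i) /sqnorm (bigD1 j) //=.
    by rewrite lerDl sumr_ge0 // => k _; exact: sqr_ge0.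
  have := @preimage_closed _ _ (fun u : 'rV[R]_m.+1 => (u *m 1%:M *m u^T) 0 0).
  move=> /(_ [set 1]); apply; first by move=> v _; exact: continuous_quad.
  exact: closed_eq.
have [u0 + hmin] := EVT_min_rV S0 cS (continuous_subspaceT (@continuous_quad R m A)).
rewrite inE => /SE Su0; set mu : R := (u0 *m A *m u0^T) 0 0 in hmin.
have ray (v : 'rV[R]_m.+1) : mu * sqnorm (v 0) <= (v *m A *m v^T) 0 0.
  have [v0|v0] := eqVneq (sqnorm (v 0)) 0.
    have -> : v = 0 by apply/rowP => j; rewrite mxE; exact: sqnorm_eq0 v0 j.
    by rewrite !mul0mx mxE /sqnorm big1 ?mulr0 // => j _; rewrite mxE expr0n.
  have vp : 0 < sqnorm (v 0) by rewrite lt_neqAle eq_sym v0 sqnorm_ge0.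
  pose s := Num.sqrt (sqnorm (v 0)).
  have sp : 0 < s by rewrite sqrtr_gt0.
  have s2 : s ^+ 2 = sqnorm (v 0) by rewrite sqr_sqrtr // ltW.
  have : s^-1 *: v \in S.
    rewrite inE; apply/SE; rewrite sqnorm_rowE linearZ /= -scalemxAl -scalemxAr.
    rewrite scalerA mxE -sqnorm_rowE -s2; field; exact: lt0r_neq0.
  move=> /hmin; rewrite linearZ /= -!scalemxAl -scalemxAr scalerA mxE.
  rewrite -s2 -ler_pdivlMr ?exprn_gt0 //; congr (_ <= _); field; exact: lt0r_neq0.
(* The quotient does not decrease in the direction of the residual [w], so the
   first-order term, which is [sqnorm w], vanishes. *)
have ev : u0 *m A = mu *: u0.
  apply/eqP; rewrite -subr_eq0; apply/eqP; set w := _ - _.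
  suff : sqnorm (w 0) = 0.
    by move=> h; apply/rowP => j; rewrite [RHS]mxE; exact: sqnorm_eq0 h j.
  apply: (@quad_linear_min _ _ ((w *m A *m w^T) 0 0 - mu * sqnorm (w 0))) => t.
  have := ray (u0 + t *: w); rewrite -subr_ge0; congr (_ <= _).
  have D (a b : 'M[R]_1) : (a + b) 0 0 = a 0 0 + b 0 0 by rewrite mxE.
  have N (b : 'M[R]_1) : (- b) 0 0 = - b 0 0 by rewrite mxE.
  have Z (k : R) (b : 'M[R]_1) : (k *: b) 0 0 = k * b 0 0 by rewrite mxE.
  have e1 : (u0 *m A *m w^T) 0 0 = sqnorm (w 0) + mu * (u0 *m w^T) 0 0.
    apply/eqP; rewrite -subr_eq; apply/eqP.
    rewrite sqnorm_rowE; transitivity (((u0 *m A - mu *: u0) *m w^T) 0 0) => //.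
    by rewrite mulmxBl D N -scalemxAl Z.
  clearbody w.
  have e2 : (w *m A *m u0^T) 0 0 = (u0 *m A *m w^T) 0 0.
    transitivity (((w *m A *m u0^T)^T) 0 0); first by rewrite [RHS]mxE.
    by rewrite !trmx_mul trmxK symA mulmxA.
  have e3 : (w *m u0^T) 0 0 = (u0 *m w^T) 0 0.
    transitivity (((w *m u0^T)^T) 0 0); first by rewrite [RHS]mxE.
    by rewrite trmx_mul trmxK.
  rewrite (sqnorm_rowE (u0 + _)).
  have -> : (u0 + t *: w)^T = u0^T + t *: w^T by rewrite linearD linearZ.
  rewrite !mulmxDl !mulmxDr -!scalemxAl -!scalemxAr.
  rewrite !D !Z e2 e3 e1 -!sqnorm_rowE Su0 -/mu.
  ring.
have u00 : u0 != 0.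
  apply: contra_eq_neq Su0 => ->.
  by rewrite /sqnorm big1 1?eq_sym ?oner_neq0 // => j _; rewrite mxE expr0n.
have cmu : c <= mu.
  rewrite -lee_fin; apply: le_trans hc _; apply: ereal_inf_lbound.
  by exists mu => //; apply/eigenvalueP; exists u0.
by apply: le_trans (ray u); rewrite ler_wpM2r ?sqnorm_ge0.
Qed.

(** * Stability of the incoherence condition *)

(** Averaging [2 |a b| <= a ^+ 2 + b ^+ 2] over all pairs of entries. *)
Lemma sum_norm_mul_le (R : realType) (I : finType) (a : I -> R) :
  \sum_i \sum_j `|a i| * `|a j| <= #|I|%:R * sqnorm a.
Proof.
have -> : #|I|%:R * sqnorm a =
    \sum_i \sum_j ((a i ^+ 2) / 2 + (a j ^+ 2) / 2).
  under eq_bigr do rewrite big_split /= sumr_const -mulr_suml -/(sqnorm a).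
  rewrite big_split /= sumr_const.
  rewrite sumrMnl -mulr_suml -/(sqnorm a).
  by rewrite -mulrnDl -splitr mulr_natl.
apply: ler_sum => i _; apply: ler_sum => j _.
rewrite -(real_normK (num_real (a i))) -(real_normK (num_real (a j))).
have := sqr_ge0 (`|a i| - `|a j|); nra.
Qed.

Lemma sqr_sum_norm_le (R : realType) (I : finType) (a : I -> R) :
  (\sum_i `|a i|) ^+ 2 <= #|I|%:R * sqnorm a.
Proof.
apply: le_trans (sum_norm_mul_le a); rewrite expr2 mulr_suml.
by apply: ler_sum => i _; rewrite mulr_sumr.
Qed.

(** Entrywise errors of size [eps / q] move a quadratic form in [q] variables
by at most [eps], so a lower bound on it survives. *)
Lemma rayleigh_perturb (R : realType) q (S G : 'M[R]_q) (c eps : R) :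
  (forall u : 'rV[R]_q, c * sqnorm (u 0) <= (u *m S *m u^T) 0 0) ->
  (forall a b, `|G a b - S a b| * q%:R <= eps) ->
  forall u : 'rV[R]_q, (c - eps) * sqnorm (u 0) <= (u *m G *m u^T) 0 0.
Proof.
move=> hS hG u; have [q0|q0] := posnP q.
  have z (v : 'I_q -> R) : sqnorm v = 0.
    by rewrite /sqnorm big1 // => -[j jq]; exfalso; rewrite q0 in jq.
  by rewrite z mulr0 mxE big1 // => -[j jq]; exfalso; rewrite q0 in jq.
have qp : 0 < q%:R :> R by rewrite ltr0n.
have quadE (A : 'M[R]_q) :
    (u *m A *m u^T) 0 0 = \sum_j \sum_i u 0 i * A i j * u 0 j.
  by rewrite mxE; apply: eq_bigr => j _; rewrite !mxE mulr_suml.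
suff : `|(u *m G *m u^T) 0 0 - (u *m S *m u^T) 0 0| <= eps * sqnorm (u 0).
  by have := hS u; rewrite ler_norml => + /andP[+ _]; lra.
rewrite !quadE -sumrB; under eq_bigr do rewrite -sumrB.
apply: (@le_trans _ _ (\sum_j \sum_i eps / q%:R * (`|u 0 j| * `|u 0 i|))).
  apply: le_trans (ler_norm_sum _ _ _) _; apply: ler_sum => j _.
  apply: le_trans (ler_norm_sum _ _ _) _; apply: ler_sum => i _.
  have -> : u 0 i * G i j * u 0 j - u 0 i * S i j * u 0 j =
     (G i j - S i j) * (u 0 j * u 0 i) by ring.
  by rewrite !normrM ler_wpM2r ?mulr_ge0 // ler_pdivlMr.
under eq_bigr do rewrite -mulr_sumr; rewrite -mulr_sumr.
have e0 : 0 <= eps.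
  by apply: le_trans (hG (Ordinal q0) (Ordinal q0)); rewrite mulr_ge0.
apply: le_trans (ler_wpM2l _ (sum_norm_mul_le (u 0))) _.
  by rewrite divr_ge0.
by rewrite card_ord mulrA divfK // gt_eqF.
Qed.

Lemma rayleigh_unitmx (R : realType) q (G : 'M[R]_q) (c : R) :
  0 < c ->
  (forall u : 'rV[R]_q, c * sqnorm (u 0) <= (u *m G *m u^T) 0 0) ->
  G \in unitmx.
Proof.
move=> c0 hG; rewrite -row_free_unit -kermx_eq0; apply/eqP/row_matrixP => i.
have /sub_kermxP k0 : (row i (kermx G) <= kermx G)%MS by exact: row_sub.
have := hG (row i (kermx G)); rewrite k0 mul0mx mxE.
rewrite pmulr_rle0 // => h; apply/rowP => j; rewrite row0 [RHS]mxE.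
have {h} : sqnorm (row i (kermx G) 0) = 0.
  by apply/eqP; rewrite eq_le h sqnorm_ge0.
by move/sqnorm_eq0; exact.
Qed.

(** If [u G = r] then [c |u|_2 ^+ 2 <= u G u^T = r u^T <= max |r| |u|_1], and
[|u|_1 ^+ 2 <= q |u|_2 ^+ 2]. *)
Lemma l1_solve_le (R : realType) q (G : 'M[R]_q) (c rho : R) (u : 'rV[R]_q) :
  0 < c -> 0 <= rho ->
  (forall v : 'rV[R]_q, c * sqnorm (v 0) <= (v *m G *m v^T) 0 0) ->
  (forall b, `|(u *m G) 0 b| <= rho) ->
  c * \sum_b `|u 0 b| <= q%:R * rho.
Proof.
move=> c0 rho0 hG hr; set s := \sum_b _.
have s0 : 0 <= s by apply: sumr_ge0.
have h1 : c * sqnorm (u 0) <= rho * s.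
  apply: le_trans (hG u) _; rewrite mxE /s mulr_sumr.
  apply: ler_sum => b _; rewrite [u^T b 0]mxE.
  apply: le_trans (ler_norm _) _; rewrite normrM ler_wpM2r //.
have h2 : s ^+ 2 <= q%:R * sqnorm (u 0).
  by have := sqr_sum_norm_le (u 0); rewrite card_ord.
have [->|sn0] := eqVneq s 0; first by rewrite mulr0 mulr_ge0.
have sp : 0 < s by rewrite lt_neqAle eq_sym sn0.
rewrite -(ler_pM2r sp); apply: (@le_trans _ _ (c * (q%:R * sqnorm (u 0)))).
  by rewrite -mulrA -expr2 ler_wpM2l // ltW.
have := ler_wpM2l (ler0n R q) h1; nra.
Qed.

Lemma infnorm_mx_ltP (R : realType) m k (A : 'M[R]_(m, k)) (b : R) : 0 < b ->
  (infnorm_mx A < b) <-> (forall i, \sum_(j < k) `|A i j| < b).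
Proof.
move=> b0; split => [/bigmax_ltP[_ h] i|h]; first exact: h.
by apply/bigmax_ltP; split.
Qed.

(** With [theta = SC SK^-1] the population regression coefficients, [SC = theta
SK], so [GC - theta GK = (GC - SC) - theta (GK - SK)] is entrywise small when
the rows of [theta] have l1 norm at most [1]; applying [GK^-1] to it costs at
most a factor [q / c] from entrywise to row-l1 norm. *)
Lemma incoherence_stable (R : realType) q r (SK GK : 'M[R]_q)
    (SC GC : 'M[R]_(r, q)) (c phi : R) :
  0 < c -> 0 < phi -> phi <= 1 -> SK^T = SK ->
  (c%:E <= lambda_min SK)%E ->
  infnorm_mx (SC *m invmx SK) <= 1 - phi ->
  (forall a b, `|GK a b - SK a b| * q%:R <= c * phi / 8) ->
  (forall a b, `|GC a b - SC a b| * q%:R <= c * phi / 8) ->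
  GK \in unitmx /\ infnorm_mx (GC *m invmx GK) < 1 - phi / 4.
Proof.
move=> c0 phi0 phi1 symS hmin hinc hK hC.
have rS := lambda_min_rayleigh symS hmin.
have uS := rayleigh_unitmx c0 rS.
have rG := rayleigh_perturb rS hK.
have cG : 0 < c - c * phi / 8.
  by rewrite subr_gt0 -mulrA gtr_pMr // ltr_pdivrMr // mul1r (le_lt_trans phi1) // ltr1n.
have uG := rayleigh_unitmx cG rG; split => //.
have [q0|q0] := posnP q.
  apply/infnorm_mx_ltP => [|i]; first lra.
  by rewrite big1 => [|[j jq]]; [lra|exfalso; rewrite q0 in jq].
have qp : 0 < q%:R :> R by rewrite ltr0n.
set theta := SC *m invmx SK in hinc.
have hth i : \sum_(j < q) `|theta i j| <= 1 - phi.
  by move/bigmax_leP : hinc => [_]; exact.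
set rho := c * phi / 8 / q%:R * 2.
have rho0 : 0 <= rho by rewrite /rho !mulr_ge0 ?invr_ge0 // ltW.
apply/infnorm_mx_ltP => [|i]; first lra.
set u := row i (GC *m invmx GK) - row i theta.
have hu b : `|(u *m GK) 0 b| <= rho.
  have -> : (u *m GK) 0 b =
      (GC i b - SC i b) - \sum_j theta i j * (GK j b - SK j b).
    rewrite /u mulmxBl -!row_mul mulmxKV //.
    under [in RHS]eq_bigr do rewrite mulrBr.
    rewrite sumrB.
    have -> : \sum_j theta i j * SK j b = SC i b.
      have := congr1 (fun A : 'M[R]_(r, q) => A i b) (mulmxKV uS SC).
      by rewrite mxE.
    by rewrite !mxE; ring.
  have h1 : `|GC i b - SC i b| <= c * phi / 8 / q%:R by rewrite ler_pdivlMr.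
  have h2 : `|\sum_j theta i j * (GK j b - SK j b)| <= c * phi / 8 / q%:R.
    apply: le_trans (ler_norm_sum _ _ _) _.
    apply: (@le_trans _ _ (\sum_j `|theta i j| * (c * phi / 8 / q%:R))).
      by apply: ler_sum => j _; rewrite normrM ler_wpM2l // ler_pdivlMr.
    rewrite -mulr_suml ger_pMl ?divr_gt0 ?mulr_gt0 //.
    by apply: le_trans (hth i) _; lra.
  apply: le_trans (ler_normB _ _) _; rewrite /rho; lra.
have := l1_solve_le cG rho0 rG hu.
have -> : q%:R * rho = c * phi / 4 by rewrite /rho; field; rewrite gt_eqF.
move=> hs.
have tri : \sum_j `|(GC *m invmx GK) i j| <=
    \sum_j `|theta i j| + \sum_j `|u 0 j|.
  rewrite -big_split /=; apply: ler_sum => j _.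
  have -> : (GC *m invmx GK) i j = theta i j + u 0 j.
    have rowB (A B : 'M[R]_(r, q)) : (row i A - row i B) 0 j = A i j - B i j.
      by rewrite !mxE.
    by rewrite /u rowB addrC subrK.
  exact: ler_normD.
apply: (le_lt_trans tri); have := hth i.
suff : \sum_j `|u 0 j| < phi / 2 by lra.
have : (c - c * phi / 8) * \sum_b `|u 0 b| < (c - c * phi / 8) * (phi / 2).
  apply: le_lt_trans hs _; rewrite -subr_gt0.
  have -> : (c - c * phi / 8) * (phi / 2) - c * phi / 4 =
     c * phi * ((4 - phi) / 16) by field.
  by rewrite !mulr_gt0 //; lra.
by rewrite ltr_pM2l.
Qed.

(** * Deterministic bounds on perturbed designs *)

Lemma mxsubE (R : zmodType) m n (A B : 'M[R]_(m, n)) i j :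
  (A - B) i j = A i j - B i j.
Proof. by rewrite !mxE. Qed.

(** Cauchy-Schwarz for upper bounds [N * al ^+ 2] that are themselves squares: the
inequality [2 |a b| <= (be / al) a ^+ 2 + (al / be) b ^+ 2] gives it without
square roots. *)
Lemma dot_le (R : realType) (I : finType) (a b : I -> R) (N al be : R) :
  0 <= N -> 0 <= al -> 0 <= be ->
  sqnorm a <= N * al ^+ 2 -> sqnorm b <= N * be ^+ 2 ->
  `|\sum_i a i * b i| <= N * al * be.
Proof.
move=> N0 al0 be0 ha hb.
have null (c e : I -> R) : sqnorm c <= 0 -> \sum_i c i * e i = 0.
  move=> c0; apply: big1 => i _; rewrite sqnorm_eq0 ?mul0r //.
  by apply/eqP; rewrite eq_le c0 sqnorm_ge0.
move: al0; rewrite le_eqVlt => /predU1P[al0|al0].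
  by move: ha; rewrite -al0 expr0n mulr0 mul0r => /null ->; rewrite normr0.
move: be0; rewrite le_eqVlt => /predU1P[be0|be0].
  move: hb; rewrite -be0 expr0n mulr0 => /(null _ a) b0.
  by under eq_bigr do rewrite mulrC; rewrite b0 normr0 mulr0.
apply: (@le_trans _ _ (\sum_i (be / al * a i ^+ 2 + al / be * b i ^+ 2) / 2)).
  apply: le_trans (ler_norm_sum _ _ _) _; apply: ler_sum => i _.
  rewrite normrM -(real_normK (num_real (a i))) -(real_normK (num_real (b i))).
  rewrite -subr_ge0.
  have -> : (be / al * `|a i| ^+ 2 + al / be * `|b i| ^+ 2) / 2 - `|a i| * `|b i| =
      (be * `|a i| - al * `|b i|) ^+ 2 / (2 * al * be).
    by field; rewrite !gt_eqF.
  by rewrite divr_ge0 ?sqr_ge0 // ltW // !mulr_gt0.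
rewrite -mulr_suml big_split /= -!mulr_sumr ler_pdivrMr // -/(sqnorm a) -/(sqnorm b).
have -> : N * al * be * 2 = be / al * (N * al ^+ 2) + al / be * (N * be ^+ 2).
  by field; rewrite !gt_eqF.
by apply: lerD; rewrite ler_wpM2l // divr_ge0 // ltW.
Qed.

(** The two cross terms and the product of the errors are inner products, each
bounded by Cauchy-Schwarz. *)
Lemma gram_shift (R : realType) (I : finType) (x x' e e' : I -> R)
    (N B del : R) :
  0 <= N -> 0 <= B -> 0 <= del ->
  sqnorm x <= N * B ^+ 2 -> sqnorm x' <= N * B ^+ 2 ->
  sqnorm e <= N * del ^+ 2 -> sqnorm e' <= N * del ^+ 2 ->
  `|\sum_i (x i + e i) * (x' i + e' i) - \sum_i x i * x' i|
    <= N * ((B *+ 2 + del) * del).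
Proof.
move=> N0 B0 d0 hx hx' he he'.
have -> : \sum_i (x i + e i) * (x' i + e' i) - \sum_i x i * x' i =
    \sum_i x i * e' i + \sum_i e i * x' i + \sum_i e i * e' i.
  by rewrite -sumrB -!big_split /=; apply: eq_bigr => i _; ring.
have -> : N * ((B *+ 2 + del) * del) =
   N * B * del + N * del * B + N * del * del by ring.
apply: le_trans (ler_normD _ _) _; apply: lerD; last exact: dot_le.
by apply: le_trans (ler_normD _ _) _; apply: lerD; exact: dot_le.
Qed.

(** The squared norm of [Z v] is a quadratic form in [v] whose coefficients, the
inner products of columns of [Z], are at most [N * be ^+ 2]. *)
Lemma sqnorm_mul_l1_le (R : realType) n d (Z : 'M[R]_(n, d)) (v : 'cV[R]_d)
    (N be : R) :
  0 <= N -> 0 <= be ->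
  (forall l, v l 0 != 0 -> sqnorm (Z^~ l) <= N * be ^+ 2) ->
  sqnorm (fun i => (Z *m v) i 0) <= N * (be * l1norm v) ^+ 2.
Proof.
move=> N0 be0 hZ.
have -> : sqnorm (fun i => (Z *m v) i 0) =
    \sum_l \sum_l' v l 0 * v l' 0 * \sum_i Z i l * Z i l'.
  rewrite /sqnorm; under eq_bigr do rewrite mxE expr2 mulr_suml.
  rewrite exchange_big /=; apply: eq_bigr => l _.
  under eq_bigr do rewrite mulr_sumr.
  rewrite exchange_big /=; apply: eq_bigr => l' _.
  by rewrite mulr_sumr; apply: eq_bigr => i _; ring.
have -> : N * (be * l1norm v) ^+ 2 =
    \sum_l \sum_l' `|v l 0| * `|v l' 0| * (N * be * be).
  under [RHS]eq_bigr do rewrite -mulr_suml -mulr_sumr.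
  by rewrite -!mulr_suml -/(l1norm v); ring.
apply: ler_sum => l _; apply: ler_sum => l' _.
have [->|vl] := eqVneq (v l 0) 0; first by rewrite normr0 !mul0r.
have [->|vl'] := eqVneq (v l' 0) 0; first by rewrite normr0 !(mulr0, mul0r).
apply: le_trans (ler_norm _) _; rewrite !normrM; apply: ler_wpM2l.
  by rewrite mulr_ge0.
by apply: dot_le => //; exact: hZ.
Qed.

Lemma sqnorm_add_le (R : realType) (I : finType) (a b : I -> R) :
  sqnorm (fun i => a i + b i) <= (sqnorm a + sqnorm b) *+ 2.
Proof.
rewrite /sqnorm -big_split -sumrMnl; apply: ler_sum => i _ /=.
have := sqr_ge0 (a i - b i); nra.
Qed.

Lemma sqnorm_le_l1 (R : realType) d (v : 'cV[R]_d) :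
  sqnorm (v^~ 0) <= l1norm v ^+ 2.
Proof.
rewrite /l1norm expr2 mulr_suml; apply: ler_sum => l _.
rewrite -(real_normK (num_real _)) expr2 ler_wpM2l // (bigD1 l) //=.
by rewrite lerDl sumr_ge0.
Qed.

Definition supported (R : realType) d (J : {set 'I_d}) (v : 'cV[R]_d) :=
  forall l, l \notin J -> v l 0 = 0.

(** The points of the cube [[-1, 1] ^ J], extended by zero off [J], whose
coordinates are multiples of [1 / k]. *)
Definition grid_point (R : realType) k d (J : {set 'I_d})
    (f : {ffun {l | l \in J} -> 'I_(k.*2.+1)}) : 'cV[R]_d :=
  \col_l (if insub l is Some s then ((f s)%:R - k%:R) / k%:R else 0).

Lemma grid_pointE (R : realType) k d (J : {set 'I_d})
    (f : {ffun {l | l \in J} -> 'I_(k.*2.+1)}) l (lJ : l \in J) :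
  grid_point R f l 0 = ((f (exist _ l lJ))%:R - k%:R) / k%:R.
Proof. by rewrite mxE insubT. Qed.

Lemma grid_point_supported (R : realType) k d (J : {set 'I_d})
    (f : {ffun {l | l \in J} -> 'I_(k.*2.+1)}) : supported J (grid_point R f).
Proof. by move=> l lJ; rewrite mxE insubF //; exact/negbTE. Qed.

Lemma grid_rounding (R : realType) k d (J : {set 'I_d}) (v : 'cV[R]_d) :
  (0 < k)%N -> supported J v -> sqnorm (v^~ 0) <= 1 ->
  exists f : {ffun {l | l \in J} -> 'I_(k.*2.+1)},
    forall l, `|(v - grid_point R f) l 0| <= k%:R^-1.
Proof.
move=> k0 sv v1.
have kp : 0 < k%:R :> R by rewrite ltr0n.
have vle l : `|v l 0| <= 1.
  rewrite -(ler_pXn2r (n := 2)) ?nnegrE // expr1n real_normK ?num_real //.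
  apply: le_trans v1; rewrite /sqnorm (bigD1 l) //= lerDl sumr_ge0 // => j _.
  exact: sqr_ge0.
pose t l := Num.truncn (k%:R * v l 0 + k%:R).
have targ l : 0 <= k%:R * v l 0 + k%:R <= k.*2%:R.
  have := vle l; rewrite ler_norml -muln2 natrM => /andP[h1 h2].
  apply/andP; split; nra.
have tlt l : (t l < k.*2.+1)%N.
  have /andP[h0 h1] := targ l; rewrite ltnS -(ler_nat R).
  by apply: le_trans h1; rewrite truncn_le.
pose f := [ffun s : {l | l \in J} => Ordinal (tlt (val s))].
exists f => l; have [lJ|lJ] := boolP (l \in J); last first.
  rewrite mxsubE grid_point_supported // sv // subr0.
  by rewrite normr0 invr_ge0 ler0n.
rewrite mxsubE grid_pointE ffunE /=.
have /andP[h0 _] := targ l; have /andP[h1 h2] := truncn_itv h0.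
have -> : v l 0 - ((t l)%:R - k%:R) / k%:R =
   (k%:R * v l 0 + k%:R - (t l)%:R) / k%:R by field; rewrite gt_eqF.
rewrite normrM normfV [`|k%:R|]ger0_norm ?ler0n // ler_piMl ?invr_ge0 ?ler0n //.
rewrite ger0_norm ?subr_ge0 // lerBlDl; move: h2; rewrite -natr1 => /ltW.
exact.
Qed.

(** A design that is well behaved on a coordinate-aligned grid of spacing [1 / k]
and on the coordinate vectors is well behaved on every vector supported on at
most [k] coordinates: rounding moves such a unit vector by at most [1] in l1
norm, and the coordinate vectors control what that costs. *)
Lemma sqnorm_mul_sparse_le (R : realType) n d (Z : 'M[R]_(n, d)) k
    (J : {set 'I_d}) (N be del : R) (v : 'cV[R]_d) :
  0 <= N -> 0 <= be -> 0 <= del -> (0 < k)%N -> (#|J| <= k)%N ->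
  (forall l, sqnorm (Z^~ l) <= N * be ^+ 2) ->
  (forall f : {ffun {l | l \in J} -> 'I_(k.*2.+1)},
     sqnorm (fun i => (Z *m grid_point R f) i 0) <=
       N * be ^+ 2 * sqnorm ((grid_point R f)^~ 0)) ->
  supported J v -> sqnorm (v^~ 0) <= del ^+ 2 ->
  sqnorm (fun i => (Z *m v) i 0) <= N * (be * (4 * del)) ^+ 2.
Proof.
move=> N0 be0 del0 k0 Jk hcol hgrid sv vdel.
have kp : 0 < k%:R :> R by rewrite ltr0n.
have NB : 0 <= N * be ^+ 2 by rewrite mulr_ge0 ?sqr_ge0.
have unit_case (w : 'cV[R]_d) : supported J w -> sqnorm (w^~ 0) <= 1 ->
    sqnorm (fun i => (Z *m w) i 0) <= N * be ^+ 2 * 16.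
  move=> sw w1; have [f hf] := grid_rounding k0 sw w1.
  set g := grid_point R f in hf; set e := w - g in hf.
  have se : supported J e.
    by move=> l lJ; rewrite mxsubE sw // grid_point_supported // subr0.
  have e1 : l1norm e <= 1.
    rewrite /l1norm (bigID (mem J)) /= [X in _ + X]big1 ?addr0; last first.
      by move=> l lJ; rewrite se // normr0.
    apply: (@le_trans _ _ (\sum_(l in J) k%:R^-1)).
      by apply: ler_sum => l _; exact: hf.
    by rewrite sumr_const -[_ *+ #|_|]mulr_natl ler_pdivrMr // mul1r ler_nat.
  have e1' : 0 <= l1norm e by apply: sumr_ge0.
  have e2 : sqnorm (e^~ 0) <= 1.
    by apply: le_trans (sqnorm_le_l1 e) _; rewrite expr_le1.
  have g2 : sqnorm (g^~ 0) <= 4.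
    have -> : g^~ 0 = (fun l => w l 0 + (- e l 0)).
      by apply/funext => l; rewrite /e mxsubE; ring.
    apply: le_trans (sqnorm_add_le _ _) _.
    have -> : sqnorm (fun l => - e l 0) = sqnorm (e^~ 0).
      by apply: eq_bigr => l _; rewrite sqrrN.
    lra.
  have -> : (fun i => (Z *m w) i 0) = (fun i => (Z *m g) i 0 + (Z *m e) i 0).
    apply/funext => i; have -> : w = g + e by rewrite /e addrC subrK.
    by rewrite mulmxDr [LHS]mxE.
  apply: le_trans (sqnorm_add_le _ _) _.
  have h1 := hgrid f; rewrite -/g in h1.
  have h2 : sqnorm (fun i => (Z *m e) i 0) <= N * be ^+ 2.
    apply: le_trans (sqnorm_mul_l1_le N0 be0 (fun l _ => hcol l)) _.
    by rewrite exprMn mulrA ler_piMr // expr_le1.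
  have := ler_wpM2l NB g2; lra.
move: del0; rewrite le_eqVlt => /predU1P[del0|del0].
  have -> : v = 0.
    apply/colP => l; rewrite mxE; apply: (@sqnorm_eq0 _ _ (v^~ 0)).
    by apply/eqP; rewrite eq_le sqnorm_ge0 (le_trans vdel) // -del0 expr0n.
  rewrite mulmx0 /sqnorm big1 => [|i _]; first by rewrite mulr_ge0 ?sqr_ge0.
  by rewrite mxE expr0n.
have sc (m : nat) (u : 'cV[R]_m) (t : R) :
    sqnorm (fun l => (t *: u) l 0) = t ^+ 2 * sqnorm (u^~ 0).
  by rewrite /sqnorm mulr_sumr; apply: eq_bigr => l _; rewrite mxE exprMn.
have := unit_case (del^-1 *: v).
rewrite -scalemxAr !sc exprVn ler_pdivrMl ?exprn_gt0 // mulr1.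
rewrite ler_pdivrMl ?exprn_gt0 // => /(_ _ vdel) h.
have -> : N * (be * (4 * del)) ^+ 2 = del ^+ 2 * (N * be ^+ 2 * 16) by ring.
by apply: h => l lJ; rewrite mxE sv // mulr0.
Qed.

(** * Independent variables and the Chernoff bound *)

Lemma measurable_le_set (R : realType) (disp : measure_display)
    (T : measurableType disp) (f g : T -> R) :
  measurable_fun setT f -> measurable_fun setT g ->
  measurable [set w | f w <= g w].
Proof.
move=> mf mg; have := measurable_fun_ler mf mg measurableT (Y := [set true]) I.
by rewrite setTI; congr measurable; apply/seteqP; split => w /=.
Qed.

Section independence.
Context (R : realType) (disp : measure_display) (T : measurableType disp)
  (P : probability T R).
Local Open Scope ereal_scope.
Import HBNNSimple.

(** Approximate [Y] from below by simple functions of [Y]; for those the claim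
is linear in the indicators of the events [Y \in B]. *)
Lemma ge0_integral_mul_le (h Y : T -> R) (c : R) :
  measurable_fun setT h -> measurable_fun setT Y ->
  (forall w, 0 <= h w)%R -> (forall w, 0 <= Y w)%R -> (0 <= c)%R ->
  (forall B : set R, measurable B ->
     \int[P]_w (h w * \1_B (Y w))%:E <= c%:E * P (Y @^-1` B)) ->
  \int[P]_w (h w * Y w)%:E <= c%:E * \int[P]_w (Y w)%:E.
Proof.
move=> mh mY h0 Y0 c0 hB.
(* Simple approximations exist for nonnegative functions on the line; [`|.|]
   agrees with the identity on the values of [Y]. *)
have mnorm : measurable_fun [set: R] (fun r : R => `|r|%:E).
  by apply/measurable_EFinP.
pose g := nnsfun_approx measurableT mnorm.
have gcvg w : EFin \o g^~ (Y w) @ \oo --> (Y w)%:E.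
  have := @cvg_nnsfun_approx _ _ _ _ measurableT _ mnorm (fun x _ => normr_ge0 x) (Y w) I.
  by rewrite /= ger0_norm.
have mgY n : measurable_fun setT (fun w => g n (Y w)) by apply: measurableT_comp.
have gnd (m n : nat) r : (m <= n)%N -> (g m r <= g n r)%R.
  by move=> mn; have /lefP := @nd_nnsfun_approx _ _ _ _ measurableT _ mnorm _ _ mn; exact.
have gY n w : (g n (Y w) <= Y w)%R.
  rewrite -lee_fin -(cvg_lim _ (gcvg w)) //; apply: lime_ge.
    by apply/cvg_ex; exists (Y w)%:E.
  by exists n => // k /= nk; rewrite lee_fin gnd.
have stepb n : \int[P]_w (h w * g n (Y w))%:E <= c%:E * \int[P]_w (g n (Y w))%:E.
  have E1 (k : T -> R) : measurable_fun setT k -> (forall w, 0 <= k w)%R ->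
      \int[P]_w (k w * g n (Y w))%:E =
      \sum_(y \in range (g n)) y%:E * \int[P]_w (k w * \1_(g n @^-1` [set y]) (Y w))%:E.
    move=> mk k0.
    transitivity (\int[P]_w \sum_(y \in range (g n))
        (y * (k w * \1_(g n @^-1` [set y]) (Y w)))%:E).
      apply: eq_integral => w _; rewrite fimfunE fsumEFin //; congr EFin.
      rewrite !fsbig_finite //= mulr_sumr; apply: eq_bigr => y _.
      by rewrite mulrCA.
    rewrite ge0_integral_fsum //; last 2 first.
    - move=> y; apply/measurable_EFinP; apply: measurable_funM => //.
      apply: measurable_funM => //; apply: measurableT_comp => //.
    - move=> y w _; rewrite lee_fin.
      have [y0|y0] := leP 0%R y; first by rewrite !mulr_ge0.
      by rewrite preimage_nnfun0 // indic0 !mulr0.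
    apply: eq_fsbigr => y; rewrite inE => -[r _ <-].
    under eq_integral do rewrite EFinM.
    rewrite ge0_integralZl_EFin //.
    - by move=> w _; rewrite lee_fin mulr_ge0.
    - by apply/measurable_EFinP; apply: measurable_funM => //; apply: measurableT_comp.
  rewrite E1 //.
  have -> : \int[P]_w (g n (Y w))%:E = \int[P]_w (cst 1%R w * g n (Y w))%:E.
    by apply: eq_integral => w _; rewrite /= mul1r.
  rewrite E1 //.
  rewrite ge0_mule_fsumr; last first.
    move=> y; have [y0|y0] := leP 0%R y.
      by rewrite mule_ge0 ?lee_fin // integral_ge0 // => w _; rewrite lee_fin mul1r.
    rewrite integral0_eq ?mule0 // => w _.
    by rewrite preimage_nnfun0 // indic0 mulr0.
  apply: lee_fsum => // y [r _ <-].
  rewrite muleCA; apply: lee_wpmul2l; first by rewrite lee_fin.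
  have mB : measurable (g n @^-1` [set g n r]) by [].
  apply: le_trans (hB _ mB) _; rewrite lee_wpmul2l ?lee_fin //.
  have -> : \int[P]_w (cst 1%R w * \1_(g n @^-1` [set g n r]) (Y w))%:E =
      \int[P]_w (\1_(Y @^-1` (g n @^-1` [set g n r])) w)%:E.
    by apply: eq_integral => w _; rewrite /= mul1r.
  rewrite integral_indic // ?setIT //.
  by rewrite -[X in measurable X]setTI; apply: mY.
have -> : \int[P]_w (h w * Y w)%:E = limn (fun n => \int[P]_w (h w * g n (Y w))%:E).
  rewrite -monotone_convergence //.
  - apply: eq_integral => w _; apply/esym/cvg_lim => //.
    have hg : (h w)%:E * (g n (Y w))%:E @[n --> \oo] --> (h w)%:E * (Y w)%:E.
      by apply: cvgeZl => //; exact: gcvg.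
    exact: hg.
  - by move=> n; apply/measurable_EFinP; exact: measurable_funM.
  - by move=> n w _; rewrite lee_fin mulr_ge0.
  - by move=> w _ m n mn; rewrite lee_fin ler_wpM2l // gnd.
apply: lime_le.
  apply: ereal_nondecreasing_is_cvgn => m n mn.
  apply: ge0_le_integral => //.
  - by move=> w _; rewrite lee_fin mulr_ge0.
  - by apply/measurable_EFinP; exact: measurable_funM.
  - by apply/measurable_EFinP; exact: measurable_funM.
  - by move=> w _; rewrite lee_fin ler_wpM2l // gnd.
apply: nearW => n; apply: le_trans (stepb n) _; rewrite lee_wpmul2l ?lee_fin //.
apply: ge0_le_integral => //.
- by move=> w _; rewrite lee_fin.
- exact/measurable_EFinP.
- exact/measurable_EFinP.
- by move=> w _; rewrite lee_fin.
Qed.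

Definition independent_rvs n (Y : 'I_n -> T -> R) : Prop :=
  forall B : 'I_n -> set R, (forall i, measurable (B i)) ->
    P (\bigcap_(i in [set: 'I_n]) (Y i @^-1` B i)) = \prod_(i < n) P (Y i @^-1` B i).

(** The indicators of [Y i \in B i] are replaced by the variables [Y i] one
index at a time. *)
Lemma independent_integral_prod_le n (Y : 'I_n -> T -> R) (b : 'I_n -> R) :
  (forall i, measurable_fun setT (Y i)) -> (forall i w, 0 <= Y i w)%R ->
  independent_rvs Y -> (forall i, \int[P]_w (Y i w)%:E <= (b i)%:E) ->
  \int[P]_w (\prod_i Y i w)%:E <= (\prod_i b i)%:E.
Proof.
move=> mY Y0 indY hb.
have b0 i : (0 <= b i)%R.
  by rewrite -lee_fin; apply: le_trans (hb i); apply: integral_ge0 => w _; rewrite lee_fin.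
pose f (k : nat) (B : 'I_n -> set R) (i : 'I_n) (w : T) : R := if (i < k)%N then Y i w else \1_(B i) (Y i w).
pose r (k : nat) (B : 'I_n -> set R) (i : 'I_n) : R := if (i < k)%N then b i else fine (P (Y i @^-1` B i)).
have mpre (i : 'I_n) B : measurable B -> measurable (Y i @^-1` B).
  by move=> mB; rewrite -[X in measurable X]setTI; apply: mY.
have f0 k B i w : (0 <= f k B i w)%R by rewrite /f; case: ifP.
have r0 k B i : (0 <= r k B i)%R by rewrite /r; case: ifP => // _; exact: fine_ge0.
have mf k B i : (forall i, measurable (B i)) -> measurable_fun setT (f k B i).
  move=> mB; rewrite /f; have [_|_] := ltnP i k; [exact: mY|exact: measurableT_comp].
suff main (k : nat) : (k <= n)%N -> forall B, (forall i, measurable (B i)) ->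
    \int[P]_w (\prod_i f k B i w)%:E <= (\prod_i r k B i)%:E.
  have := main n (leqnn n) (fun=> setT) (fun=> measurableT).
  congr (_ <= _).
    by apply: eq_integral => w _; congr EFin; apply: eq_bigr => i _; rewrite /f ltn_ord.
  by congr EFin; apply: eq_bigr => i _; rewrite /r ltn_ord.
elim: k => [_ B mB|k IH kn B mB].
  have -> : \int[P]_w (\prod_i f 0 B i w)%:E =
      \int[P]_w (\1_(\bigcap_(i in [set: 'I_n]) (Y i @^-1` B i)) w)%:E.
    apply: eq_integral => w _; congr EFin; rewrite indicE.
    have [wB|wB] := boolP (w \in _).
      rewrite big1 // => i _; rewrite /f /= indicE mem_set //.
      by move: wB; rewrite inE => /(_ i I).
    have : exists i, ~ B i (Y i w).
      apply/existsNP; apply: contraNnot wB => h; apply/mem_set => i _; exact: h.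
    by move=> [i Bi]; rewrite (bigD1 i) //= /f /= indicE memNset // mul0r.
  rewrite integral_indic // ?setIT; last first.
    by apply: fin_bigcap_measurable => // i _; exact: mpre.
  have -> : (\prod_i r 0 B i)%:E = P (\bigcap_(i in [set: 'I_n]) (Y i @^-1` B i)).
    rewrite (indY B mB) -prodEFin; apply: eq_bigr => i _.
    by rewrite /r /= fineK //; apply: fin_num_measure; exact: mpre.
  exact: lexx.
pose i0 := Ordinal kn.
rewrite (bigD1 i0) //=.
have rest i : i != i0 ->
    (i < k.+1)%N = (i < k)%N.
  move=> ii0; rewrite ltnS leq_eqVlt.
  by have /negbTE -> : (nat_of_ord i != k) by apply: contra ii0 => /eqP ik; apply/eqP/val_inj.
pose h w := (\prod_(i | i != i0) f k B i w)%R.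
pose c := (\prod_(i | i != i0) r k B i)%R.
have c0 : (0 <= c)%R by apply: prodr_ge0 => i _.
have -> : \int[P]_w (\prod_i f k.+1 B i w)%:E = \int[P]_w (h w * Y i0 w)%:E.
  apply: eq_integral => w _; congr EFin; rewrite (bigD1 i0) //= mulrC; congr (_ * _)%R.
    by apply: eq_bigr => i ii0; rewrite /f rest.
  by rewrite /f /= ltnSn.
have -> : (\prod_(i | i != i0) r k.+1 B i)%R = c.
  by apply: eq_bigr => i ii0; rewrite /r rest.
have mh : measurable_fun setT h.
  rewrite /h; under eq_fun do rewrite -big_filter.
  by apply: measurable_prod => i _; exact: mf.
have -> : r k.+1 B i0 = b i0 by rewrite /r /= ltnSn.
apply: (@le_trans _ _ (c%:E * \int[P]_w (Y i0 w)%:E)); last first.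
  by rewrite mulrC EFinM lee_wpmul2l ?lee_fin.
apply: ge0_integral_mul_le => //.
  by move=> w; apply: prodr_ge0 => i _.
move=> B0 mB0.
pose B' i := if i == i0 then B0 else B i.
have mB' i : measurable (B' i) by rewrite /B'; case: ifP.
have := IH (ltnW kn) B' mB'; congr (_ <= _).
  apply: eq_integral => w _; congr EFin; rewrite (bigD1 i0) //= mulrC; congr (_ * _)%R.
    by apply: eq_bigr => i ii0; rewrite /f /B' (negbTE ii0).
  by rewrite /f /B' /= ltnn eqxx.
rewrite (bigD1 i0) //= mulrC EFinM; congr (_%:E * _).
  by apply: eq_bigr => i ii0; rewrite /r /B' (negbTE ii0).
by rewrite /r /B' /= ltnn eqxx fineK // fin_num_measure //; exact: mpre.
Qed.

Lemma chernoff_sum_le n (V : 'I_n -> T -> R) (b a : R) :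
  (forall i, measurable_fun setT (V i)) -> independent_rvs V ->
  (forall i, \int[P]_w (expR (V i w))%:E <= b%:E) ->
  P [set w | (a <= \sum_i V i w)%R] <= (b ^+ n * expR (- a))%:E.
Proof.
move=> mV indV hb.
have mE i : measurable_fun setT (fun w => expR (V i w)) by apply: measurableT_comp.
have indE : independent_rvs (fun i w => expR (V i w)).
  move=> B mB; apply: (indV (fun i => expR @^-1` B i)) => i.
  by rewrite -[X in measurable X]setTI; exact: measurable_expR.
have mS : measurable_fun setT (fun w => \sum_i V i w)%R by exact: measurable_sum.
have mA : measurable [set w | (a <= \sum_i V i w)%R].
  exact: measurable_le_set.
have := independent_integral_prod_le mE (fun i w => expR_ge0 _) indE hb.
rewrite prodr_const card_ord => hprod.
rewrite mulrC EFinM.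
apply: le_trans (lee_wpmul2l _ hprod); last by rewrite lee_fin expR_ge0.
have -> : P [set w | (a <= \sum_i V i w)%R] =
    \int[P]_w (\1_([set w | (a <= \sum_i V i w)%R]) w)%:E.
  by rewrite integral_indic // setIT.
rewrite -ge0_integralZl_EFin //; last 2 first.
- by move=> w _; rewrite lee_fin prodr_ge0 // => i _; exact: expR_ge0.
- by apply/measurable_EFinP; apply: measurable_prod => i _; exact: mE.
apply: ge0_le_integral => //.
- by apply/measurable_EFinP.
- apply/measurable_EFinP; apply: measurable_funM => //.
  by apply: measurable_prod => i _; exact: mE.
move=> w _; rewrite -EFinM lee_fin -expR_sum -expRD indicE.
have [|_] := boolP (w \in _); last exact: expR_ge0.
by rewrite inE /= => aw; rewrite -expR0 ler_expR addrC subr_ge0.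
Qed.

End independence.

(** * Moments of sub-Gaussian variables and of their products *)

(** For negative [x] the factor [1 + y] of [expR (- y) * (1 + y) <= 1] turns the
claim into a polynomial inequality. *)
Lemma expR_le_taylor1 (R : realType) (x : R) :
  expR x <= 1 + x + x ^+ 2 * expR `|x|.
Proof.
have [x0|x0] := leP 0 x.
  rewrite ger0_norm //.
  have h1 : expR x * (1 - x) <= 1.
    have := expRxMexpNx_1 x; have := expR_ge1Dx (- x); have := expR_ge0 x; nra.
  have h2 : expR x - 1 <= x * expR x by lra.
  have := ler_wpM2l x0 h2; lra.
rewrite ltr0_norm //; set y := - x; have -> : x = - y by rewrite opprK.
have y0 : 0 < y by rewrite oppr_gt0.
clearbody y.
have h1 : expR (- y) * (1 + y) <= 1.
  have := expRxMexpNx_1 y; have := expR_ge1Dx y; have := expR_ge0 (- y); nra.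
have h2 : 1 <= expR y by rewrite -expR0 ler_expR ltW.
have h3 := expR_ge0 (- y).
have : expR (- y) <= 1 - y + y ^+ 2.
  have : (expR (- y) - (1 - y + y ^+ 2)) * (1 + y) <= 0.
    have : 0 <= y ^+ 3 by rewrite exprn_ge0 // ltW.
    rewrite exprS; nra.
  by rewrite pmulr_lle0 ?subr_le0 // ltr_wpDl.
have : y ^+ 2 <= y ^+ 2 * expR y by rewrite ler_peMr ?sqr_ge0.
rewrite sqrrN; lra.
Qed.

(** The exponent [x ^+ 2 / 4] is reached, up to a constant, by one of the lines
[m x - m ^+ 2] of integer slope [m]: complete the square at [m] nearest to
[`|x| / 2]. *)
Lemma expR_sqr_le_line (R : realType) (x : R) :
  exists m : nat, expR (x ^+ 2 / 4) <=
    expR (4^-1) * expR (- m%:R ^+ 2) * (expR (m%:R * x) + expR (- (m%:R * x))).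
Proof.
pose m := Num.truncn (`|x| / 2 + 2^-1); exists m.
have h0 : 0 <= `|x| / 2 + 2^-1 by rewrite addr_ge0.
have /andP[h1 h2] := truncn_itv h0; rewrite -/m in h1 h2; rewrite -(natr1 m) in h2.
apply: (@le_trans _ _ (expR (4^-1) * expR (- m%:R ^+ 2) * expR (m%:R * `|x|))).
  rewrite -!expRD ler_expR -(real_normK (num_real x)).
  have : (`|x| / 2 - m%:R) ^+ 2 <= (2^-1) ^+ 2.
    rewrite -ler_sqrt ?sqr_ge0 // !sqrtr_sqr ler_norml ger0_norm //.
    by apply/andP; split; lra.
  by nra.
apply: ler_wpM2l; first by rewrite mulr_ge0 ?expR_ge0.
have [x0|x0] := leP 0 x; first by rewrite ger0_norm // lerDl expR_ge0.
by rewrite ltr0_norm // mulrN lerDr expR_ge0.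
Qed.

(** The sum over [m : nat] of [2 expR (1 / 4) expR (- m / 2)], which bounds the
expectations of the terms on the right of [expR_sqr_le_line] for a sub-Gaussian
variable with parameter [1]. *)
Definition expsq_const (R : realType) : R :=
  expR (4^-1) *+ 2 / (1 - expR (- 2^-1)).

Lemma expRN12_lt1 (R : realType) : expR (- 2^-1) < 1 :> R.
Proof. by rewrite -[ltRHS]expR0 ltr_expR oppr_lt0. Qed.

Lemma expsq_const_ge1 (R : realType) : 1 <= expsq_const R.
Proof.
have h := expRN12_lt1 R.
rewrite /expsq_const ler_pdivlMr ?subr_gt0 // mul1r.
have := expR_ge0 (- 2^-1 : R); have := expR_ge1Dx (4^-1 : R); lra.
Qed.

Section subgaussian.
Context (R : realType) (disp : measure_display) (T : measurableType disp)
  (P : probability T R).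
Local Open Scope ereal_scope.

Definition mgf_le (U : T -> R) (S : R) : Prop :=
  measurable_fun setT U /\
  forall t : R, \int[P]_w (expR (t * U w))%:E <= (expR (S * t ^+ 2 / 2))%:E.

(** Unlike [mgf_le], a single moment; by [2 |x y| <= x ^+ 2 + y ^+ 2] two variables
with this property control the exponential moments of their product. *)
Definition expsq_le (U : T -> R) (S : R) : Prop :=
  measurable_fun setT U /\
  \int[P]_w (expR (U w ^+ 2 / (4 * S)))%:E <= (expsq_const R)%:E.

(** Integrating the lines of [expR_sqr_le_line], the one of slope [m] contributes at
most [2 expR (1 / 4) expR (- m ^+ 2) expR (m ^+ 2 / 2)], and [m ^+ 2 >= m] makes
the sum over [m] geometric. *)
Lemma mgf_le_expsq_le (U : T -> R) (S : R) :
  (0 < S)%R -> mgf_le U S -> expsq_le U S.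
Proof.
move=> S0 [mU hU]; split => //.
pose s := Num.sqrt S.
have s0 : (0 < s)%R by rewrite sqrtr_gt0.
have s2 : (s ^+ 2 = S)%R by rewrite sqr_sqrtr // ltW.
pose C (m : nat) : R := (expR (4^-1) * expR (- m%:R ^+ 2))%R.
have C0 m : (0 <= C m)%R by rewrite mulr_ge0 ?expR_ge0.
pose f (m : nat) (w : T) : \bar R :=
  (C m)%:E * ((expR (m%:R / s * U w))%:E + (expR (- (m%:R / s) * U w))%:E).
have mexp (t : R) : measurable_fun setT (fun w => (expR (t * U w))%:E).
  by apply/measurable_EFinP; apply: measurableT_comp => //; exact: measurable_funM.
have mf m : measurable_fun setT (f m).
  by apply: measurable_funeM; apply: emeasurable_funD.
have f0 m w : 0 <= f m w.
  by rewrite mule_ge0 ?lee_fin // -EFinD lee_fin addr_ge0 ?expR_ge0.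
apply: (@le_trans _ _ (\int[P]_w (\sum_(m <oo) f m w))).
  apply: ge0_le_integral => //.
  - apply/measurable_EFinP; apply: measurableT_comp => //.
    by apply: measurable_funM => //; exact: measurable_funX.
  - exact: ge0_emeasurable_sum.
  move=> w _; have [m hm] := expR_sqr_le_line (U w / s).
  have := @nneseries_lim_ge R (f^~ w) xpredT 0 m.+1 (fun n _ _ => f0 n w).
  apply: le_trans; rewrite big_mkord big_ord_recr /=.
  have hs : 0 <= \sum_(i < m) f i w by apply: sume_ge0 => i _.
  apply: le_trans (leeDr _ hs).
  rewrite /f mulNr -EFinD -EFinM lee_fin; move: hm.
  have -> : (m%:R * (U w / s) = m%:R / s * U w)%R by ring.
  rewrite exprMn exprVn s2; congr (expR _ <= _)%R.
  by field; rewrite gt_eqF.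
rewrite integral_nneseries //.
have hint m : \int[P]_w f m w <= (geometric (expR (4^-1) *+ 2) (expR (- 2^-1)) m)%:E.
  rewrite /f ge0_integralZl_EFin //; last 2 first.
  - by move=> w _; rewrite -EFinD lee_fin addr_ge0 ?expR_ge0.
  - exact: emeasurable_funD.
  rewrite ge0_integralD //.
  have e2 (t : R) : (t ^+ 2 = m%:R ^+ 2 / S)%R ->
      \int[P]_w (expR (t * U w))%:E <= (expR (m%:R ^+ 2 / 2))%:E.
    move=> tE; apply: le_trans (hU t) _; rewrite lee_fin ler_expR tE.
    by rewrite mulrCA divff ?gt_eqF // mulr1.
  apply: (@le_trans _ _ ((C m)%:E * ((expR (m%:R ^+ 2 / 2))%:E + (expR (m%:R ^+ 2 / 2))%:E))).
    rewrite lee_wpmul2l ?lee_fin //; apply: leeD; apply: e2.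
      by rewrite exprMn exprVn s2.
    by rewrite sqrrN exprMn exprVn s2.
  rewrite -EFinD -EFinM lee_fin /C /geometric /= -expRM_natl.
  rewrite -subr_ge0; set A := expR _; set B := expR _; set D := expR _.
  set E := expR _; have -> : (A *+ 2 * B - A * D * (E + E) = A *+ 2 * (B - D * E))%R by ring.
  rewrite mulr_ge0 ?mulrn_wge0 ?expR_ge0 // subr_ge0 /B /D /E -expRD ler_expR.
  have : (m%:R <= m%:R ^+ 2 :> R)%R by rewrite -natrX ler_nat; case: (m) => // k; rewrite -mulnn leq_pmulr.
  lra.
apply: lime_le.
  by apply: is_cvg_nneseries => m _ _; apply: integral_ge0 => w _; exact: f0.
apply: nearW => n; apply: (@le_trans _ _ (\sum_(0 <= m < n)
    (geometric (expR (4^-1) *+ 2) (expR (- 2^-1)) m)%:E)).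
  by apply: lee_sum => m _; exact: hint.
rewrite sumEFin lee_fin.
have z1 := expRN12_lt1 R.
have z1' : (expR (- 2^-1) != 1 :> R)%R by rewrite lt_eqF.
have := congr1 (fun u => u n) (geometric_seriesE (expR (4^-1) *+ 2 : R) z1').
rewrite /series /= => ->.
rewrite /expsq_const ler_wpM2r ?invr_ge0 ?subr_ge0 ?(ltW z1) //.
by rewrite ler_piMr ?mulrn_wge0 ?expR_ge0 // lerBlDr lerDl exprn_ge0 ?expR_ge0.
Qed.

Lemma expsq_integrable (U : T -> R) (S : R) : expsq_le U S ->
  P.-integrable setT (fun w => (expR (U w ^+ 2 / (4 * S)))%:E).
Proof.
move=> [mU hU]; apply/integrableP; split.
  apply/measurable_EFinP; apply: measurableT_comp => //.
  by apply: measurable_funM => //; exact: measurable_funX.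
under eq_integral do rewrite gee0_abs ?lee_fin ?expR_ge0 //.
by apply: le_lt_trans hU _; rewrite ltry.
Qed.

Lemma expsq_mul_integrable (X Y : T -> R) (S : R) : (0 < S)%R ->
  expsq_le X S -> expsq_le Y S ->
  P.-integrable setT (fun w => (X w * Y w)%:E).
Proof.
move=> S0 hX hY; have [mX _] := hX; have [mY _] := hY.
have S4 : (0 < 4 * S)%R by rewrite mulr_gt0.
have iE := integrableD measurableT (expsq_integrable hX) (expsq_integrable hY).
have iS := integrableZl measurableT (2 * S)%R iE.
apply: le_integrable iS => //.
  by apply/measurable_EFinP; exact: measurable_funM.
move=> w _; rewrite -EFinD -EFinM !abse_EFin lee_fin.
have eX := expR_ge1Dx (X w ^+ 2 / (4 * S)).
have eY := expR_ge1Dx (Y w ^+ 2 / (4 * S)).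
rewrite [leRHS]ger0_norm; last by rewrite mulr_ge0 ?addr_ge0 ?expR_ge0 // mulr_ge0 // ltW.
have h : (X w ^+ 2 / (4 * S) + Y w ^+ 2 / (4 * S) <=
    expR (X w ^+ 2 / (4 * S)) + expR (Y w ^+ 2 / (4 * S)))%R by lra.
have S2 : (0 <= 2 * S)%R by rewrite mulr_ge0 // ltW.
apply: le_trans (ler_wpM2l S2 h).
have -> : (2 * S * (X w ^+ 2 / (4 * S) + Y w ^+ 2 / (4 * S)) =
    (X w ^+ 2 + Y w ^+ 2) / 2)%R by field; rewrite gt_eqF.
rewrite normrM -(real_normK (num_real (X w))) -(real_normK (num_real (Y w))).
have := sqr_ge0 (`|X w| - `|Y w|)%R; nra.
Qed.

(** With [V = X Y], [e ^ (l V) <= 1 + l V + (l V) ^ 2 e ^ |l V|], and for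
[|l| <= 1 / (8 S)] the last term is at most [l ^+ 2] times a multiple of
[e ^ (X ^+ 2 / (4 S)) + e ^ (Y ^+ 2 / (4 S))]. *)
Lemma expsq_mul_mgf_le (X Y : T -> R) (S mu l : R) : (0 < S)%R ->
  expsq_le X S -> expsq_le Y S ->
  \int[P]_w (X w * Y w)%:E = mu%:E -> (`|l| <= (8 * S)^-1)%R ->
  \int[P]_w (expR (l * (X w * Y w - mu)))%:E <=
    (expR (l ^+ 2 * (128 * S ^+ 2 * expsq_const R)))%:E.
Proof.
move=> S0 hX hY hmu hl; have [mX bX] := hX; have [mY bY] := hY.
set H := (128 * S ^+ 2 * expsq_const R)%R.
pose eX w := expR (X w ^+ 2 / (4 * S)); pose eY w := expR (Y w ^+ 2 / (4 * S)).
have mXY : measurable_fun setT (fun w => X w * Y w)%R by exact: measurable_funM.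
have S8 : (0 < 8 * S)%R by rewrite mulr_gt0.
have ptw w : (expR (l * (X w * Y w)) <=
    1 + l * (X w * Y w) + l ^+ 2 * (64 * S ^+ 2) * (eX w + eY w))%R.
  set V := (X w * Y w)%R.
  apply: le_trans (expR_le_taylor1 _) _; rewrite lerD2l exprMn.
  rewrite -(mulrA _ (V ^+ 2)%R) -(mulrA _ (64 * S ^+ 2)%R).
  apply: ler_wpM2l; first exact: sqr_ge0.
  set q := (`|V| / (8 * S))%R.
  have q0 : (0 <= q)%R by rewrite divr_ge0 // ltW.
  have h1 : (expR `|l * V| <= expR q)%R.
    by rewrite ler_expR normrM mulrC ler_wpM2l.
  have h2 : (V ^+ 2 <= 128 * S ^+ 2 * expR q)%R.
    have := expR_ge1Dxn 1 q0; rewrite (_ : 2`!%:R = 2 :> R)%R // => h.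
    have -> : (V ^+ 2 = 64 * S ^+ 2 * q ^+ 2)%R.
      by rewrite /q -(real_normK (num_real V)); field; rewrite gt_eqF.
    have : (0 <= S ^+ 2)%R by exact: sqr_ge0.
    nra.
  apply: (@le_trans _ _ (128 * S ^+ 2 * expR q * expR q)%R).
    by apply: ler_pM => //; rewrite ?sqr_ge0 ?expR_ge0.
  have -> : (64 * S ^+ 2 * (eX w + eY w) = 128 * S ^+ 2 * ((eX w + eY w) / 2))%R by field.
  rewrite -mulrA ler_wpM2l //; first by rewrite mulr_ge0 // sqr_ge0.
  pose aX := (X w ^+ 2 / (8 * S))%R; pose aY := (Y w ^+ 2 / (8 * S))%R.
  have -> : eX w = (expR aX * expR aX)%R.
    by rewrite -expRD /eX; congr expR; rewrite /aX; field; rewrite gt_eqF.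
  have -> : eY w = (expR aY * expR aY)%R.
    by rewrite -expRD /eY; congr expR; rewrite /aY; field; rewrite gt_eqF.
  have : (expR q * expR q <= expR aX * expR aY)%R.
    rewrite -!expRD ler_expR /aX /aY /q -!mulrDl ler_wpM2r ?invr_ge0 ?(ltW S8) //.
    rewrite /V normrM -(real_normK (num_real (X w))) -(real_normK (num_real (Y w))).
    have := sqr_ge0 (`|X w| - `|Y w|)%R; nra.
  have := sqr_ge0 (expR aX - expR aY)%R; nra.
have iX := expsq_integrable hX; have iY := expsq_integrable hY.
have iXY := expsq_mul_integrable S0 hX hY.
have mel : measurable_fun setT (fun w => expR (l * (X w * Y w)))%R.
  by apply: measurableT_comp => //; exact: measurable_funM.
have i1 : P.-integrable setT (fun w => (cst 1%R w)%:E).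
  exact: finite_measure_integrable_cst.
have iV := integrableZl measurableT l iXY.
have i1V := integrableD measurableT i1 iV.
have iE := integrableD measurableT iX iY.
have iZ := integrableZl measurableT (l ^+ 2 * (64 * S ^+ 2))%R iE.
have bound : \int[P]_w (expR (l * (X w * Y w)))%:E <=
    (1 + l * mu + l ^+ 2 * H)%:E.
  apply: (@le_trans _ _ (\int[P]_w ((cst 1%R w)%:E + l%:E * (X w * Y w)%:E +
     (l ^+ 2 * (64 * S ^+ 2))%:E * ((eX w)%:E + (eY w)%:E)))).
    apply: ge0_le_integral => //.
    - exact/measurable_EFinP.
    - have := integrableD measurableT i1V iZ.
      by move=> /integrableP[].
    - by move=> w _; rewrite -!(EFinM, EFinD) lee_fin; exact: ptw.
  rewrite integralD // integralD // integralZl // integralZl // integralD //.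
  have -> : \int[P]_w (cst 1%R w)%:E = 1.
    apply: (etrans (@integral_cst _ _ _ P setT measurableT 1%:E)).
    by rewrite mul1e; exact: probability_setT.
  rewrite hmu.
  rewrite (EFinD (1 + l * mu)%R); apply: leeD; first by rewrite EFinD EFinM.
  apply: (@le_trans _ _ ((l ^+ 2 * (64 * S ^+ 2))%:E * ((expsq_const R)%:E + (expsq_const R)%:E))).
    apply: lee_wpmul2l; last exact: leeD.
    by rewrite lee_fin mulr_ge0 ?sqr_ge0 // mulr_ge0 ?sqr_ge0.
  rewrite -EFinD -EFinM lee_fin /H; lra.
have -> : \int[P]_w (expR (l * (X w * Y w - mu)))%:E =
    \int[P]_w ((expR (- (l * mu)))%:E * (expR (l * (X w * Y w)))%:E).
  by apply: eq_integral => w _; rewrite -EFinM -expRD mulrBr addrC.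
rewrite ge0_integralZl_EFin ?expR_ge0 //; last exact/measurable_EFinP.
apply: le_trans (lee_wpmul2l _ bound) _; first by rewrite lee_fin expR_ge0.
rewrite -EFinM lee_fin.
have -> : expR (l ^+ 2 * H) = (expR (- (l * mu)) * expR (l * mu + l ^+ 2 * H))%R.
  by rewrite -expRD; congr expR; ring.
by rewrite ler_wpM2l ?expR_ge0 // -addrA; exact: expR_ge1Dx.
Qed.

End subgaussian.

(** * Tails of sums of squares and of products *)

(** Chernoff's exponent [l * t - l ^+ 2 * H], with [H] the constant of
[expsq_mul_mgf_le], has the maximum [t ^+ 2 / (4 * H)]. *)
Definition mul_tail_const (R : realType) (S : R) : R :=
  512 * S ^+ 2 * expsq_const R.

Lemma mul_tail_const_gt0 (R : realType) (S : R) : 0 < S -> 0 < mul_tail_const S.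
Proof.
move=> S0; apply: mulr_gt0; last by rewrite (lt_le_trans ltr01) // expsq_const_ge1.
by apply: mulr_gt0; [exact: ltr0Sn|exact: exprn_gt0].
Qed.

Section tails.
Context (R : realType) (disp : measure_display) (T : measurableType disp)
  (P : probability T R).
Local Open Scope ereal_scope.

Lemma expsq_sum_sqr_tail n (U : 'I_n -> T -> R) (S : R) : (0 < S)%R ->
  (forall i, expsq_le P (U i) S) ->
  independent_rvs P (fun i w => U i w ^+ 2 / (4 * S))%R ->
  P [set w | (n%:R * (4 * S * (ln (expsq_const R) + 1)) <= \sum_i U i w ^+ 2)%R]
    <= (expR (- n%:R))%:E.
Proof.
move=> S0 hU ind; set C := expsq_const R.
have C0 : (0 < C)%R by rewrite (lt_le_trans ltr01) // expsq_const_ge1.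
have S4 : (0 < 4 * S)%R by rewrite mulr_gt0.
have mV i : measurable_fun setT (fun w => U i w ^+ 2 / (4 * S))%R.
  by have [mU _] := hU i; apply: measurable_funM => //; exact: measurable_funX.
have := chernoff_sum_le (n%:R * (ln C + 1))%R mV ind (fun i => (hU i).2).
have -> : [set w | (n%:R * (ln C + 1) <= \sum_i U i w ^+ 2 / (4 * S))%R] =
    [set w | (n%:R * (4 * S * (ln C + 1)) <= \sum_i U i w ^+ 2)%R].
  have -> : (n%:R * (4 * S * (ln C + 1)) = n%:R * (ln C + 1) * (4 * S))%R by ring.
  by apply/seteqP; split => w /=; rewrite -mulr_suml ler_pdivlMr.
move=> h; apply: le_trans h _; rewrite lee_fin.
have -> : (C ^+ n = expR (n%:R * ln C))%R by rewrite expRM_natl lnK ?posrE.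
by rewrite -expRD ler_expR; lra.
Qed.

(** Bernstein's inequality in the range of [t] where the tail is Gaussian: the best
exponent [l = t / (2 H)] then is one for which [expsq_mul_mgf_le] holds. *)
Lemma expsq_sum_mul_tail n (X Y : 'I_n -> T -> R) (S mu t : R) : (0 < S)%R ->
  (forall i, expsq_le P (X i) S) -> (forall i, expsq_le P (Y i) S) ->
  (forall i, \int[P]_w (X i w * Y i w)%:E = mu%:E) ->
  (forall l : R, independent_rvs P (fun i w => l * (X i w * Y i w - mu)))%R ->
  (0 <= t)%R -> (t <= 32 * S * expsq_const R)%R ->
  P [set w | (n%:R * t <= `|\sum_i (X i w * Y i w - mu)|)%R] <=
    (expR (- (n%:R * t ^+ 2 / mul_tail_const S)) *+ 2)%:E.
Proof.
rewrite /mul_tail_const => S0 hX hY hmu ind t0 tS; set C := expsq_const R.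
have C1 : (1 <= C)%R by exact: expsq_const_ge1.
have C0 : (0 < C)%R by rewrite (lt_le_trans ltr01).
set H := (128 * S ^+ 2 * C)%R.
have H0 : (0 < H)%R by rewrite !mulr_gt0 // exprn_gt0.
pose l := (t / (2 * H))%R.
have l0 : (0 <= l)%R by rewrite divr_ge0 // mulr_ge0 // ltW.
have lS : (l <= (8 * S)^-1)%R.
  rewrite /l ler_pdivrMr ?mulr_gt0 // mulrC; apply: le_trans tS _.
  rewrite le_eqVlt; apply/orP; left; apply/eqP.
  by rewrite /H /C; field; rewrite gt_eqF.
have mV i (e : R) : measurable_fun setT (fun w => e * (X i w * Y i w - mu))%R.
  have [mX _] := hX i; have [mY _] := hY i.
  by apply: measurable_funM => //; apply: measurable_funB => //; exact: measurable_funM.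
(* [e] is [l] or [- l]: one side of the absolute value each. *)
have side (e : R) : (`|e| = l)%R ->
    P [set w | (n%:R * t * l <= \sum_i e * (X i w * Y i w - mu))%R] <=
      (expR (- (n%:R * t ^+ 2 / (512 * S ^+ 2 * C))))%:E.
  move=> el.
  have hE i : \int[P]_w (expR (e * (X i w * Y i w - mu)))%:E <= (expR (e ^+ 2 * H))%:E.
    by apply: expsq_mul_mgf_le => //; rewrite el.
  have := chernoff_sum_le (n%:R * t * l)%R (fun i => mV i e) (ind e) hE.
  move=> h; apply: le_trans h _; rewrite lee_fin.
  rewrite -expRM_natl -expRD ler_expR -(real_normK (num_real e)) el /l.
  rewrite le_eqVlt; apply/orP; left; apply/eqP.
  by rewrite /H; field; rewrite !gt_eqF.
have mA (e : R) : measurable [set w | (n%:R * t * l <= \sum_i e * (X i w * Y i w - mu))%R].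
  by apply: measurable_le_set => //; apply: measurable_sum => i; exact: mV.
apply: (@le_trans _ _ (P ([set w | (n%:R * t * l <= \sum_i l * (X i w * Y i w - mu))%R] `|`
    [set w | (n%:R * t * l <= \sum_i - l * (X i w * Y i w - mu))%R]))).
  apply: le_measure; rewrite ?inE.
  - apply: measurable_le_set => //; apply: measurableT_comp => //.
    by apply: measurable_sum => i; have := mV i 1%R; under eq_fun do rewrite mul1r.
  - exact: measurableU.
  move=> w /=; rewrite -!mulr_sumr; set s := (\sum_i _)%R => h.
  have [s0|s0] := leP 0%R s.
    by left; rewrite ger0_norm // in h; rewrite mulrC ler_wpM2l.
  by right; rewrite ltr0_norm // in h; rewrite mulNr -mulrN mulrC ler_wpM2l.
rewrite mulr2n EFinD.
apply: le_trans (measureU2 _ _ _) _; [exact: mA|exact: mA|].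
apply: leeD; apply: side; first by rewrite ger0_norm.
by rewrite normrN ger0_norm.
Qed.

End tails.

(** * Sub-Gaussian matrices *)

Lemma delta_mulE (R : realType) n m (A : 'M[R]_(n, m)) i j :
  (A *m (delta_mx j 0 : 'cV[R]_m)) i 0 = A i j.
Proof. by rewrite -colE mxE. Qed.

Lemma sqnorm_delta (R : realType) m (j : 'I_m) :
  sqnorm ((delta_mx j 0 : 'cV[R]_m)^~ 0) = 1.
Proof.
rewrite /sqnorm (bigD1 j) //= big1 => [|l lj].
  by rewrite mxE !eqxx expr1n addr0.
by rewrite mxE (negbTE lj) expr0n.
Qed.

Lemma l2norm_eq1 (R : realType) m (u : 'cV[R]_m) :
  sqnorm (u^~ 0) = 1 -> l2norm u = 1.
Proof. by move=> u1; rewrite /l2norm -/(sqnorm (u^~ 0)) u1 sqrtr1. Qed.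

Section row_functions.
Context (R : realType) (C : Type).

(** The generators of [vec_measurable], so that [g_sigma_algebraType G] is the
product space as a measurable type. *)
Let G : set (set (C -> R)) :=
  [set (fun f : C -> R => f c) @^-1` B | c in [set: C] & B in @measurable _ R].

Lemma vec_measurable_coord c :
  measurable_fun setT (fun f : g_sigma_algebraType G => f c).
Proof.
move=> _ B mB; rewrite setTI; apply: sub_sigma_algebra.
by exists c => //; exists B.
Qed.

Lemma vec_measurable_preimage (g : g_sigma_algebraType G -> R) :
  measurable_fun setT g ->
  forall B, measurable B -> vec_measurable ((g : (C -> R) -> R) @^-1` B).
Proof. by move=> mg B mB; have := mg measurableT B mB; rewrite setTI. Qed.

Lemma independent_vectors_comp (disp : measure_display)
    (T : measurableType disp) (P : probability T R) n (X : 'I_n -> T -> C -> R)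
    (g : g_sigma_algebraType G -> R) :
  measurable_fun setT g -> independent_vectors P X ->
  independent_rvs P (fun i w => g (X i w)).
Proof.
move=> mg indX B mB; apply: (indX (fun i => g @^-1` B i)) => i.
exact: vec_measurable_preimage.
Qed.

End row_functions.

Section sub_gaussian_matrix.
Context (R : realType) (disp : measure_display) (T : measurableType disp)
  (P : probability T R).
Local Open Scope ereal_scope.

Lemma union_bound (I : finType) (E : I -> set T) (b : R) :
  (forall x, measurable (E x)) -> (forall x, P (E x) <= b%:E) ->
  P [set w | exists x, E x w] <= (#|I|%:R * b)%:E.
Proof.
move=> mE hE.
have -> : [set w | exists x, E x w] = \big[setU/set0]_(x : I) E x.
  apply/seteqP; split => [w [x Ex]|w].
    by rewrite -bigcup_seq; exists x => //=; rewrite mem_index_enum.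
  by rewrite -bigcup_seq => -[x _ Ex]; exists x.
have sub (s : seq I) : P (\big[setU/set0]_(x <- s) E x) <= \sum_(x <- s) P (E x).
  elim: s => [|x s IH]; first by rewrite !big_nil measure0.
  rewrite !big_cons; apply: le_trans (measureU2 _ (mE x) _) _.
    exact: bigsetU_measurable.
  by apply: leeD.
apply: le_trans (sub _) _.
apply: (@le_trans _ _ (\sum_(x : I) b%:E)); first by apply: lee_sum => x _.
by rewrite sumEFin sumr_const mulr_natl.
Qed.

Context n m (A : T -> 'M[R]_(n, m)) (Sigma : 'M[R]_m) (s2 S : R).
Hypothesis hA : sub_gaussian_mx P A Sigma s2.
Hypothesis s2S : (s2 <= S)%R.
Hypothesis S0 : (0 < S)%R.

Lemma sub_gaussian_mx_integrable i j : P.-integrable setT (fun w => (A w i j)%:E).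
Proof.
have [_ _ _ /(_ _ (l2norm_eq1 (sqnorm_delta R j)) i)] := hA.
move=> [s' _ [+ _]]; rewrite Lfun1_integrable.
by under eq_fun do rewrite delta_mulE.
Qed.

Lemma sub_gaussian_mx_measurable i j : measurable_fun setT (fun w => A w i j).
Proof. by have /integrableP[/measurable_EFinP] := sub_gaussian_mx_integrable i j. Qed.

Lemma sub_gaussian_mx_mul_measurable (v : 'cV[R]_m) i :
  measurable_fun setT (fun w => (A w *m v) i 0%R).
Proof.
under eq_fun do rewrite mxE.
apply: measurable_sum => l; apply: measurable_funM => //.
exact: sub_gaussian_mx_measurable.
Qed.

Lemma sub_gaussian_mx_mean i j : \int[P]_w (A w i j)%:E = 0.
Proof. by have [_ /(_ i j) + _ _] := hA; rewrite unlock. Qed.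

Lemma sub_gaussian_mx_cov i j k :
  \int[P]_w (A w i j * A w i k)%:E = (Sigma j k)%:E.
Proof.
have [_ m0 /(_ i j k) + _] := hA.
rewrite unlock !m0 /= => <-; rewrite unlock.
apply: eq_integral => w _; congr EFin.
by rewrite -[A w i j]subr0 -[A w i k]subr0.
Qed.

Lemma sub_gaussian_mx_mgf_le (u : 'cV[R]_m) i : sqnorm (u^~ 0%R) = 1%R ->
  mgf_le P (fun w => (A w *m u) i 0%R) S.
Proof.
move=> u1; split; first exact: sub_gaussian_mx_mul_measurable.
have mean : \int[P]_w ((A w *m u) i 0%R)%:E = 0.
  transitivity (\int[P]_w (\sum_(l < m) (u l 0%R)%:E * (A w i l)%:E)).
    apply: eq_integral => w _; rewrite mxE -sumEFin; apply: eq_bigr => l _.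
    by rewrite -EFinM mulrC.
  rewrite integral_sum //; last first.
    by move=> l; apply: integrableZl => //; exact: sub_gaussian_mx_integrable.
  apply: big1 => l _; rewrite integralZl //; last exact: sub_gaussian_mx_integrable.
  by rewrite sub_gaussian_mx_mean mule0.
have [_ _ _ /(_ u (l2norm_eq1 u1) i)] := hA.
move=> [s' s's2 [_ hs]] t; have := hs t; rewrite unlock mean /= => h.
apply: le_trans (_ : _ <= (expR (s' * t ^+ 2 / 2))%:E) _.
  by move: h; under eq_integral do rewrite subr0.
rewrite lee_fin ler_expR ler_pM2r // ler_wpM2r ?sqr_ge0 //.
exact: le_trans s's2 s2S.
Qed.

Lemma sub_gaussian_mx_expsq_le (u : 'cV[R]_m) i : sqnorm (u^~ 0%R) = 1%R ->
  expsq_le P (fun w => (A w *m u) i 0%R) S.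
Proof. by move=> u1; apply: mgf_le_expsq_le => //; exact: sub_gaussian_mx_mgf_le. Qed.

(** At this level, times [n], the Chernoff bound [expsq_const R ^+ n * expR (- a)]
for [n] squares equals [expR (- n)]. *)
Definition sqr_bound (S : R) : R := (4 * S * (ln (expsq_const R) + 1))%R.

Lemma sqr_bound_ge0 : (0 <= sqr_bound S)%R.
Proof.
by rewrite mulr_ge0 ?mulr_ge0 ?(ltW S0) // addr_ge0 ?ln_ge0 ?expsq_const_ge1.
Qed.

(** Normalise [v]; the entries of [A v] are then independent sub-Gaussian variables
with parameter at most [S]. *)
Lemma sub_gaussian_mx_sqr_tail (v : 'cV[R]_m) :
  P [set w | (n%:R * sqr_bound S * sqnorm (v^~ 0) <
              sqnorm (fun i => (A w *m v) i 0))%R] <= (expR (- n%:R))%:E.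
Proof.
have [v0|v0] := eqVneq (sqnorm (v^~ 0%R)) 0%R.
  have -> : v = 0%R by apply/colP => l; rewrite mxE; exact: sqnorm_eq0 v0 l.
  rewrite (_ : [set w | _] = set0) ?measure0 ?lee_fin ?expR_ge0 //.
  apply/seteqP; split => w //=.
  rewrite /sqnorm !big1 ?mulr0 ?ltxx // => l _; first by rewrite mulmx0 mxE expr0n.
  by rewrite mxE expr0n.
set q := sqnorm (v^~ 0%R) in v0 *.
have q0 : (0 < q)%R by rewrite lt_neqAle eq_sym v0 sqnorm_ge0.
pose u : 'cV[R]_m := ((Num.sqrt q)^-1 *: v)%R.
have sq2 : ((Num.sqrt q) ^+ 2 = q)%R by rewrite sqr_sqrtr // ltW.
have u1 : sqnorm (u^~ 0%R) = 1%R.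
  have -> : sqnorm (u^~ 0%R) = (q^-1 * q)%R.
    by rewrite /sqnorm mulr_sumr; apply: eq_bigr => l _; rewrite mxE exprMn exprVn sq2.
  by rewrite mulVf.
have ind : independent_rvs P (fun i w => (A w *m u) i 0 ^+ 2 / (4 * S))%R.
  have [[ind _] _ _ _] := hA.
  have := @independent_vectors_comp R 'I_m _ T P n _
    (fun f => (\sum_l f l * u l 0) ^+ 2 / (4 * S))%R _ ind.
  have -> : (fun i w => (\sum_l A w i l * u l 0) ^+ 2 / (4 * S))%R =
     (fun i w => (A w *m u) i 0 ^+ 2 / (4 * S))%R.
    by apply/funext => i; apply/funext => w; rewrite mxE.
  apply; apply: measurable_funM => //; apply: measurable_funX.
  apply: measurable_sum => l; apply: measurable_funM => //.
  exact: vec_measurable_coord.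
apply: le_trans (expsq_sum_sqr_tail S0 (fun i => sub_gaussian_mx_expsq_le i u1) ind).
have msq (x : 'cV[R]_m) : measurable_fun setT (fun w => sqnorm (fun i => (A w *m x) i 0%R)).
  apply: measurable_sum => i; apply: measurable_funX.
  exact: sub_gaussian_mx_mul_measurable.
apply: le_measure; rewrite ?inE.
- rewrite -[X in measurable X]setCK; apply: measurableC.
  rewrite (_ : ~` _ = [set w | (sqnorm (fun i => (A w *m v) i 0) <= n%:R * sqr_bound S * q)%R]).
    exact: measurable_le_set.
  by apply/seteqP; split => w /=; rewrite leNgt => /negP.
- by apply: measurable_le_set => //; exact: (msq u).
move=> w /= /ltW.
have -> : (\sum_(i < n) (A w *m u) i 0 ^+ 2 = q^-1 * sqnorm (fun i => (A w *m v) i 0))%R.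
  rewrite /sqnorm mulr_sumr; apply: eq_bigr => i _.
  by rewrite /u -scalemxAr [X in (X ^+ 2)%R]mxE exprMn exprVn sq2.
by rewrite -ler_pdivlMr // [leRHS]mulrC /sqr_bound mulrA.
Qed.

Lemma sub_gaussian_mx_gram_tail j k (t : R) :
  (0 <= t)%R -> (t <= 32 * S * expsq_const R)%R ->
  P [set w | (n%:R * t <= `|\sum_i (A w i j * A w i k - Sigma j k)|)%R] <=
    (expR (- (n%:R * t ^+ 2 / (mul_tail_const S))) *+ 2)%:E.
Proof.
move=> t0 tS.
have hE l i : expsq_le P (fun w => A w i l) S.
  have := sub_gaussian_mx_expsq_le i (sqnorm_delta R l).
  have -> // : (fun w => (A w *m (delta_mx l 0 : 'cV[R]_m)) i 0)%R = (fun w => A w i l).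
  by apply/funext => w; rewrite delta_mulE.
apply: expsq_sum_mul_tail => //.
  by move=> i; exact: sub_gaussian_mx_cov.
move=> l; have [[ind _] _ _ _] := hA.
have := @independent_vectors_comp R 'I_m _ T P n _
  (fun f => l * (f j * f k - Sigma j k))%R _ ind.
apply; apply: measurable_funM => //; apply: measurable_funB => //.
by apply: measurable_funM; exact: vec_measurable_coord.
Qed.

End sub_gaussian_matrix.

(** * Measurability of the events *)

Section matrix_measurability.
Context (disp : measure_display) (T : measurableType disp) (R : realType).

Definition mx_measurable m k (A : T -> 'M[R]_(m, k)) : Prop :=
  forall i j, measurable_fun setT (fun w => A w i j).

Lemma mx_measurable_mul m k l (A : T -> 'M[R]_(m, k)) (B : T -> 'M[R]_(k, l)) :
  mx_measurable A -> mx_measurable B -> mx_measurable (fun w => A w *m B w).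
Proof.
move=> mA mB i j; under eq_fun do rewrite mxE.
by apply: measurable_sum => a; exact: measurable_funM.
Qed.

Lemma mx_measurable_det m (A : T -> 'M[R]_m) :
  mx_measurable A -> measurable_fun setT (fun w => \det (A w)).
Proof.
move=> mA; apply: measurable_sum => s; apply: measurable_funM => //.
by apply: measurable_prod => i _.
Qed.

Lemma mx_measurable_adj m (A : T -> 'M[R]_m) :
  mx_measurable A -> mx_measurable (fun w => \adj (A w)).
Proof.
move=> mA i j; under eq_fun do rewrite mxE.
apply: measurable_funM => //; apply: mx_measurable_det => a b.
by under eq_fun do rewrite !mxE; exact: mA.
Qed.

Lemma measurable_bigmax (I : Type) (s : seq I) (h : I -> T -> R) :
  (forall i, measurable_fun setT (h i)) ->
  measurable_fun setT (fun w => \big[Num.max/0]_(i <- s) h i w).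
Proof.
move=> mh; elim: s => [|i s IH].
  by under eq_fun do rewrite big_nil; exact: measurable_cst.
under eq_fun do rewrite big_cons; exact: measurable_maxr.
Qed.

Lemma mx_measurable_infnorm m k (A : T -> 'M[R]_(m, k)) :
  mx_measurable A -> measurable_fun setT (fun w => infnorm_mx (A w)).
Proof.
move=> mA; apply: measurable_bigmax => i; apply: measurable_sum => j.
exact: measurableT_comp.
Qed.

Lemma infnorm_mxZ m k (a : R) (A : 'M[R]_(m, k)) :
  infnorm_mx (a *: A) = `|a| * infnorm_mx A.
Proof.
rewrite /infnorm_mx; apply: (big_ind2 (fun x y => x = `|a| * y)).
- by rewrite mulr0.
- by move=> _ x _ y -> ->; rewrite maxr_pMr.
by move=> i _; rewrite mulr_sumr; apply: eq_bigr => j _; rewrite mxE normrM.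
Qed.

(** By Cramer's rule the condition on the inverse is a polynomial one. *)
Lemma measurable_incoherence q r (G : T -> 'M[R]_q) (C : T -> 'M[R]_(r, q)) c :
  mx_measurable G -> mx_measurable C ->
  measurable [set w | G w \notin unitmx \/ c <= infnorm_mx (C w *m invmx (G w))].
Proof.
move=> mG mC.
rewrite (_ : [set w | _] = [set w | `|\det (G w)| <= 0] `|`
    [set w | c * `|\det (G w)| <= infnorm_mx (C w *m \adj (G w))]); last first.
  apply/seteqP; split => w /=; rewrite normr_le0 unitmxE unitfE.
    have [d0|d0] := eqVneq (\det (G w)) 0; first by left.
    move=> [//|h]; right; move: h; rewrite /invmx unitmxE unitfE d0.
    by rewrite -scalemxAr infnorm_mxZ normfV mulrC ler_pdivlMr ?normr_gt0.
  have [d0|d0] := eqVneq (\det (G w)) 0; first by left.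
  move=> [//|h]; right; rewrite /invmx unitmxE unitfE d0.
  by rewrite -scalemxAr infnorm_mxZ normfV mulrC ler_pdivlMr ?normr_gt0.
have mdet := mx_measurable_det mG.
have mabs : measurable_fun setT (fun w => `|\det (G w)|) by exact: measurableT_comp.
apply: measurableU; first exact: measurable_le_set.
apply: measurable_le_set; first exact: measurable_funM.
by apply: mx_measurable_infnorm; apply: mx_measurable_mul => //; exact: mx_measurable_adj.
Qed.

End matrix_measurability.

Section events.
Context (R : realType) (disp : measure_display) (T : measurableType disp)
  (P : probability T R) (n p d : nat) (M : tsem P n p d)
  (pihat : 'I_p -> 'I_d -> {RV P >-> R}).

Lemma Xhat_measurable : mx_measurable (Xhat M pihat).
Proof.
move=> i j; under eq_fun do rewrite !mxE.
apply: measurable_sum => l; apply: measurable_funM.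
  by under eq_fun do rewrite mxE; exact: measurable_funPT.
by under eq_fun do rewrite mxE; exact: measurable_funPT.
Qed.

Lemma incoherence_failure_measurable (phi : R) :
  measurable (incoherence_failure M pihat phi).
Proof.
have mgram (S S' : {set 'I_p}) : mx_measurable (fun w => gram_sub (Xhat M pihat w) S S').
  move=> a b; under eq_fun do rewrite mxE.
  apply: measurable_funM => //; apply: mx_measurable_mul => i j.
    by under eq_fun do rewrite 2!mxE; exact: Xhat_measurable.
  by under eq_fun do rewrite mxE; exact: Xhat_measurable.
exact: measurable_incoherence.
Qed.

Lemma max_error_measurable (norm : 'cV[R]_d -> R) (c : R) :
  (forall v : T -> 'cV[R]_d, mx_measurable v -> measurable_fun setT (fun w => norm (v w))) ->
  measurable [set w | max_error M pihat norm w <= c].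
Proof.
move=> mnorm; apply: measurable_le_set => //.
apply: measurable_bigmax => j; apply: mnorm => l k.
by under eq_fun do rewrite !mxE; exact: measurable_funB.
Qed.

Lemma l1norm_measurable (v : T -> 'cV[R]_d) :
  mx_measurable v -> measurable_fun setT (fun w => l1norm (v w)).
Proof. by move=> mv; apply: measurable_sum => l; exact: measurableT_comp. Qed.

Lemma l2norm_measurable (v : T -> 'cV[R]_d) :
  mx_measurable v -> measurable_fun setT (fun w => l2norm (v w)).
Proof.
move=> mv; apply: (@measurableT_comp _ _ _ _ _ _ (@Num.sqrt R)).
  by apply: continuous_measurable_fun; exact: sqrt_continuous.
by apply: measurable_sum => l; exact: measurable_funX.
Qed.

Lemma same_support_measurable : measurable (same_support M pihat).
Proof.
rewrite (_ : same_support M pihat = \bigcap_(j in [set: 'I_p])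
    \bigcap_(l in [set: 'I_d]) [set w | (pihat j l w != 0) = (pistar M j l 0 != 0)]).
  apply: fin_bigcap_measurable => // j _; apply: fin_bigcap_measurable => // l _.
  have m0 : measurable (pihat j l @^-1` [set 0]).
    by rewrite -[X in measurable X]setTI; exact: measurable_funPT.
  case: (pistar M j l 0 != 0).
    rewrite (_ : [set w | _] = ~` (pihat j l @^-1` [set 0])); first exact: measurableC.
    by apply/seteqP; split => w /= => [/eqP|/eqP ->].
  rewrite (_ : [set w | _] = pihat j l @^-1` [set 0]) //.
  by apply/seteqP; split => w /= => [/negbFE/eqP|->]; rewrite ?eqxx.
apply/seteqP; split => w /= h j.
  by move=> _ l _; have /setP/(_ l) := h j; rewrite !inE /pihat_vec mxE.
by apply/setP => l; rewrite !inE /pihat_vec mxE; exact: (h j I l I).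
Qed.

Lemma high_probability_setC (c1 c2 : R) (E : set T) : measurable E ->
  high_probability P n p d c1 c2 E ->
  (P (~` E) <= (c1 * expR (- (c2 * ln (maxn (maxn d p) n)%:R)))%:E)%E.
Proof.
move=> mE; rewrite /high_probability probability_setC //.
have : (P E \is a fin_num)%E by exact: fin_num_measure.
case: (P E) => // r _; rewrite !lee_fin => h.
lra.
Qed.

End events.

(** * Failure probability at a fixed sample size *)

Lemma measurable_lt_set (R : realType) (disp : measure_display)
    (T : measurableType disp) (f g : T -> R) :
  measurable_fun setT f -> measurable_fun setT g ->
  measurable [set w | f w < g w].
Proof.
move=> mf mg; rewrite (_ : [set w | _] = ~` [set w | g w <= f w]).
  by apply: measurableC; exact: measurable_le_set.
by apply/seteqP; split => w /=; rewrite ltNge => /negP.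
Qed.

Lemma measurable_exists (disp : measure_display) (T : measurableType disp)
    (I : finType) (E : I -> set T) :
  (forall x, measurable (E x)) -> measurable [set w | exists x, E x w].
Proof.
move=> mE; rewrite (_ : [set w | _] = \bigcup_(x in [set: I]) E x).
  exact: fin_bigcup_measurable.
by apply/seteqP; split => w [x]; [exists x|move=> _; exists x].
Qed.

Lemma sub_gaussian_mx_sqnorm_measurable (R : realType) (disp : measure_display)
    (T : measurableType disp) (P : probability T R) n m (A : T -> 'M[R]_(n, m))
    (Sigma : 'M[R]_m) (s2 : R) (v : 'cV[R]_m) :
  sub_gaussian_mx P A Sigma s2 ->
  measurable_fun setT (fun w => sqnorm (fun i => (A w *m v) i 0)).
Proof.
move=> hA; apply: measurable_sum => i; apply: measurable_funX.
exact: sub_gaussian_mx_mul_measurable hA v i.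
Qed.

Lemma sqnorm_col (R : realType) n m (A : 'M[R]_(n, m)) j :
  sqnorm (A^~ j) = sqnorm (fun i => (A *m (delta_mx j 0 : 'cV[R]_m)) i 0).
Proof. by apply: eq_bigr => i _; rewrite delta_mulE. Qed.

Lemma sub_gaussian_mx_col_tail (R : realType) (disp : measure_display)
    (T : measurableType disp) (P : probability T R) n m (A : T -> 'M[R]_(n, m))
    (Sigma : 'M[R]_m) (s2 S : R) j :
  sub_gaussian_mx P A Sigma s2 -> s2 <= S -> 0 < S ->
  measurable [set w | n%:R * sqr_bound S < sqnorm ((A w)^~ j)] /\
  (P [set w | (n%:R * sqr_bound S < sqnorm ((A w)^~ j))%R] <= (expR (- n%:R))%:E)%E.
Proof.
move=> hA s2S S0.
have -> : [set w | n%:R * sqr_bound S < sqnorm ((A w)^~ j)] =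
    [set w | n%:R * sqr_bound S * sqnorm ((delta_mx j 0 : 'cV[R]_m)^~ 0) <
      sqnorm (fun i => (A w *m (delta_mx j 0 : 'cV[R]_m)) i 0)].
  by apply/seteqP; split => w /=; rewrite sqnorm_delta mulr1 -sqnorm_col.
split; last exact: sub_gaussian_mx_sqr_tail hA s2S S0 _.
by apply: measurable_lt_set => //; exact: sub_gaussian_mx_sqnorm_measurable hA.
Qed.

Lemma sqr_sqr_bound (R : realType) (S : R) : 0 < S ->
  Num.sqrt (sqr_bound S) ^+ 2 = sqr_bound S.
Proof. by move=> S0; rewrite sqr_sqrtr // sqr_bound_ge0. Qed.

Lemma gram_subE (R : realType) n p (A : 'M[R]_(n, p)) (S S' : {set 'I_p}) a b :
  gram_sub A S S' a b = n%:R^-1 * \sum_i A i (enum_val a) * A i (enum_val b).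
Proof.
by rewrite mxE [X in _ * X]mxE; congr (_ * _); apply: eq_bigr => i _; rewrite !mxE.
Qed.

Section fixed_sample_size.
Context (R : realType) (disp : measure_display) (T : measurableType disp)
  (P : probability T R) (n p d : nat) (M : tsem P n p d)
  (pihat : 'I_p -> 'I_d -> {RV P >-> R}) (k1 k2 : nat)
  (SigmaZ : 'I_p -> 'M[R]_d) (SigmaX : 'M[R]_p)
  (sigma_eps sigma_eta sigma_Z sigma_X : R) (phi Cmin : R).
Hypothesis hA : assumption_A M k1 k2 SigmaZ SigmaX sigma_eps sigma_eta sigma_Z sigma_X.
Hypothesis n_gt0 : (0 < n)%N.
Hypotheses (phi_gt0 : 0 < phi) (phi_le1 : phi <= 1) (Cmin_gt0 : 0 < Cmin).

Let K := J (betastar M).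
Let i1 := Ordinal n_gt0.
Hypothesis hinc : infnorm_mx (Sigma_sub M i1 (~: K)%SET K
                   *m invmx (Sigma_sub M i1 K K)) <= 1 - phi.
Hypothesis hCmin : (Cmin%:E <= lambda_min (Sigma_sub M i1 K K))%E.

Lemma Sigma_subE (S S' : {set 'I_p}) a b :
  Sigma_sub M i1 S S' a b = SigmaX (enum_val a) (enum_val b).
Proof.
have := sub_gaussian_mx_cov (A_X hA) i1 (enum_val a) (enum_val b).
move=> /(congr1 fine) /= <-; rewrite mxE unlock; congr fine.
apply: eq_integral => w _; congr EFin.
by rewrite mxE big_ord1 !mxE.
Qed.

Lemma Sigma_sub_sym (S : {set 'I_p}) : (Sigma_sub M i1 S S)^T = Sigma_sub M i1 S S.
Proof.
apply/matrixP => a b; rewrite mxE !mxE; congr (fine (expectation P _)).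
by apply/funext => w; rewrite !mxE !big_ord1 !mxE mulrC.
Qed.

Lemma failure_of_empty_support w :
  #|K| = 0%N -> ~ incoherence_failure M pihat phi w.
Proof.
rewrite /incoherence_failure /= -/K; move: (gram_sub _ _ K) (gram_sub _ _ K).
move: #|K| => q G H q0; rewrite {}q0 in G H *.
case; first by rewrite unitmxE det_mx00 unitr1.
rewrite /infnorm_mx; under eq_bigr do rewrite big_ord0.
have -> : \big[Num.max/0]_(i < #|~: K|%SET) 0 = 0 :> R.
  by apply: (big_ind (fun x : R => x = 0)) => // x y -> ->; rewrite maxxx.
by move: phi_le1; lra.
Qed.

(** Without regression coefficients in the first stage [X* = 0], and then the
quadratic form of the population Gram matrix vanishes. *)
Lemma support_empty_of_k1_eq0 : k1 = 0%N -> #|K| = 0%N.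
Proof.
move=> k10; apply/eqP/negPn/negP; rewrite -lt0n => q0.
have pi0 j : pistar M j = 0.
  have := A_pi_sparse hA j; rewrite k10 leqn0 cards_eq0 => /eqP/setP j0.
  apply/colP => l; rewrite mxE; apply/eqP.
  by have := j0 l; rewrite !inE => /negbFE.
have X0 w : Xstar M w = 0.
  by apply/matrixP => i j; rewrite mxE pi0 mulmx0 !mxE.
have S0 : Sigma_sub M i1 K K = 0.
  apply/matrixP => a b; rewrite mxE [RHS]mxE (_ : (fun w => _) = cst 0).
    by rewrite expectation_cst.
  by apply/funext => w; rewrite X0 mxE big_ord1 !mxE mul0r.
have := lambda_min_rayleigh (Sigma_sub_sym K) hCmin (delta_mx 0 (Ordinal q0)).
rewrite S0 mulmx0 mul0mx mxE pmulr_rle0 // => h.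
have : sqnorm ((delta_mx 0 (Ordinal q0) : 'rV[R]_#|K|) 0) = 0.
  by apply/eqP; rewrite eq_le h sqnorm_ge0.
by move/sqnorm_eq0/(_ (Ordinal q0)); rewrite mxE !eqxx => /eqP; rewrite oner_eq0.
Qed.

Lemma Xhat_subE w i j :
  Xhat M pihat w i j - Xstar M w i j =
  (Zmx M w j *m (pihat_vec pihat w j - pistar M j)) i 0.
Proof. by rewrite mulmxBr mxsubE !mxE. Qed.

(** On the event that the second moments of the columns of [X*] are close to
their expectations and that the columns of [Xhat - X*] are short, the Gram
matrix of [Xhat] is entrywise within [Cmin * phi / (8 #|K|)] of the population
one. *)
Lemma no_incoherence_failure w (t B del : R) :
  0 <= B -> 0 <= del -> (B *+ 2 + del) * del <= t ->
  t *+ 2 * #|K|%:R <= Cmin * phi / 8 ->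
  (forall j k, `|\sum_i (Xstar M w i j * Xstar M w i k - SigmaX j k)| <= n%:R * t) ->
  (forall j, sqnorm ((Xstar M w)^~ j) <= n%:R * B ^+ 2) ->
  (forall j, sqnorm (fun i => Xhat M pihat w i j - Xstar M w i j) <= n%:R * del ^+ 2) ->
  ~ incoherence_failure M pihat phi w.
Proof.
move=> B0 del0 hdel ht hX hB hD.
have np : 0 < n%:R :> R by rewrite ltr0n.
have close (S S' : {set 'I_p}) a b :
    `|gram_sub (Xhat M pihat w) S S' a b - Sigma_sub M i1 S S' a b| * #|K|%:R
      <= Cmin * phi / 8.
  apply: le_trans ht; rewrite ler_wpM2r //.
  set j := enum_val a; set k := enum_val b.
  rewrite gram_subE Sigma_subE -/j -/k.
  have -> : SigmaX j k = n%:R^-1 * \sum_(i < n) SigmaX j k.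
    by rewrite sumr_const card_ord -(mulr_natl (SigmaX j k)) mulKf // gt_eqF.
  rewrite -mulrBr normrM gtr0_norm ?invr_gt0 // ler_pdivrMl //.
  set s := \sum_i _ * _; set r := \sum_(i < n) _.
  set s0 := \sum_i Xstar M w i j * Xstar M w i k.
  have h1 : `|s - s0| <= n%:R * t.
    apply: le_trans (_ : _ <= n%:R * ((B *+ 2 + del) * del)) _; last by rewrite ler_wpM2l.
    have := gram_shift (ltW np) B0 del0 (hB j) (hB k) (hD j) (hD k).
    congr (`|_ - _| <= _); apply: eq_bigr => i _.
    by rewrite (addrC (Xstar M w i j)) subrK (addrC (Xstar M w i k)) subrK.
  have h2 : `|s0 - r| <= n%:R * t by rewrite /s0 /r -sumrB; exact: hX.
  have -> : s - r = (s - s0) + (s0 - r) by rewrite addrA subrK.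
  by apply: le_trans (ler_normD _ _) _; rewrite mulr2n mulrDr; apply: lerD.
have [uG hG] := incoherence_stable Cmin_gt0 phi_gt0 phi_le1 (Sigma_sub_sym K) hCmin hinc
  (close K K) (close (~: K)%SET K).
rewrite /incoherence_failure /= -/K; case; first by rewrite uG.
by rewrite leNgt hG.
Qed.

Definition shift_le (w : T) (del : R) : Prop := forall j,
  sqnorm (fun i => Xhat M pihat w i j - Xstar M w i j) <= n%:R * del ^+ 2.

(** The event [E] carries what is known about the first stage; failure on [E] needs
one of the [p * p] Gram entries of [X*] or of its [p] column norms to be
exceptional. *)
Lemma incoherence_failure_prob_le (S t del : R) (E : set T) :
  0 < S -> sigma_X ^+ 2 <= S -> 0 <= del ->
  (Num.sqrt (sqr_bound S) *+ 2 + del) * del <= t ->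
  t <= 32 * S * expsq_const R -> t *+ 2 * #|K|%:R <= Cmin * phi / 8 ->
  measurable E -> (forall w, E w -> shift_le w del) ->
  (P (incoherence_failure M pihat phi) <= P (~` E) +
    (p%:R * p%:R * (expR (- (n%:R * t ^+ 2 / (mul_tail_const S))) *+ 2) +
     p%:R * expR (- n%:R))%:E)%E.
Proof.
move=> S0 sS del0 hdel tS tK mE hE.
set B := Num.sqrt (sqr_bound S).
have B0 : 0 <= B by exact: sqrtr_ge0.
have t0 : 0 <= t by apply: le_trans hdel; rewrite mulr_ge0 // addr_ge0 // mulrn_wge0.
have hX := A_X hA.
pose F1 (x : 'I_p * 'I_p) := [set w | n%:R * t <=
  `|\sum_i (Xstar M w i x.1 * Xstar M w i x.2 - SigmaX x.1 x.2)|].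
pose F2 j := [set w | n%:R * sqr_bound S < sqnorm ((Xstar M w)^~ j)].
have mF1 x : measurable (F1 x).
  apply: measurable_le_set => //; apply: measurableT_comp => //.
  apply: measurable_sum => i; apply: measurable_funB => //.
  by apply: measurable_funM; exact: sub_gaussian_mx_measurable hX _ _.
have mF2 j : measurable (F2 j) by exact: (sub_gaussian_mx_col_tail j hX sS S0).1.
have mU1 := measurable_exists mF1; have mU2 := measurable_exists mF2.
apply: (@le_trans _ _ (P (~` E `|` ([set w | exists x, F1 x w] `|` [set w | exists j, F2 j w])))).
  apply: le_measure; rewrite ?inE.
  - exact: incoherence_failure_measurable.
  - by apply: measurableU; [exact: measurableC|exact: measurableU].
  move=> w fw; apply: contrapT => /not_orP[/contrapT Ew /not_orP[h1 h2]].
  apply: (no_incoherence_failure B0 del0 hdel tK) fw => //.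
  - move=> j k; have /forallNP/(_ (j, k)) := h1.
    by rewrite /F1 /= => /negP; rewrite -ltNge => /ltW.
  - move=> j; have /forallNP/(_ j) := h2.
    by rewrite /F2 /= => /negP; rewrite -leNgt sqr_sqr_bound.
  - exact: hE.
apply: le_trans (measureU2 _ _ _) _; [exact: measurableC|exact: measurableU|].
apply: leeD => //; apply: le_trans (measureU2 _ _ _) _ => //.
rewrite EFinD; apply: leeD.
  have := union_bound mF1 (fun x => sub_gaussian_mx_gram_tail hX sS S0 x.1 x.2 t0 tS).
  by rewrite card_prod card_ord natrM.
have := union_bound mF2 (fun j => (sub_gaussian_mx_col_tail j hX sS S0).2).
by rewrite card_ord.
Qed.

Lemma max_error_le (norm : 'cV[R]_d -> R) w rho j :
  max_error M pihat norm w <= rho ->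
  norm (pihat_vec pihat w j - pistar M j) <= rho.
Proof. by move=> /bigmax_leP[_]; exact. Qed.

Lemma column_event (S : R) : 0 < S -> sigma_Z ^+ 2 <= S ->
  exists F : set T, [/\ measurable F,
    (P F <= (p%:R * d%:R * expR (- n%:R))%:E)%E &
    forall w, ~ F w -> forall j l,
      sqnorm ((Zmx M w j)^~ l) <= n%:R * Num.sqrt (sqr_bound S) ^+ 2].
Proof.
move=> S0 sS.
pose F (x : 'I_p * 'I_d) := [set w | n%:R * sqr_bound S < sqnorm ((Zmx M w x.1)^~ x.2)].
have tail x := sub_gaussian_mx_col_tail x.2 (A_Z hA x.1) sS S0.
exists [set w | exists x, F x w]; split.
- by apply: measurable_exists => x; exact: (tail x).1.
- have := union_bound (fun x => (tail x).1) (fun x => (tail x).2).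
  by rewrite card_prod !card_ord natrM.
move=> w /forallNP h j l; have := h (j, l).
by rewrite /F /= => /negP; rewrite -leNgt sqr_sqr_bound.
Qed.

(** A column of [Xhat - X*] is a combination of columns of [Z_j] with weights of
total mass at most [rho]. *)
Lemma l1_shift_event (S rho : R) : 0 < S -> sigma_Z ^+ 2 <= S -> 0 <= rho ->
  exists E : set T, [/\ measurable E,
    forall w, E w -> shift_le w (Num.sqrt (sqr_bound S) * rho) &
    (P (~` E) <= P (~` [set w | (max_error M pihat (@l1norm R d) w <= rho)%R]) +
       (p%:R * d%:R * expR (- n%:R))%:E)%E].
Proof.
move=> S0 sS rho0; have [F [mF PF hF]] := column_event S0 sS.
set G := [set w | max_error M pihat (@l1norm R d) w <= rho].
have mG : measurable G by apply: max_error_measurable; exact: l1norm_measurable.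
exists (G `&` ~` F); split.
- by apply: measurableI => //; exact: measurableC.
- move=> w [Gw Fw] j; under eq_fun do rewrite Xhat_subE.
  have := sqnorm_mul_l1_le (ler0n _ n) (sqrtr_ge0 _) (fun l _ => hF w Fw j l).
  move=> h; apply: le_trans (h _) _; rewrite ler_wpM2l // ler_pXn2r //.
  - by rewrite ler_wpM2l ?sqrtr_ge0 //; exact: max_error_le Gw.
  - by rewrite nnegrE mulr_ge0 ?sqrtr_ge0 // sumr_ge0.
  - by rewrite nnegrE mulr_ge0 ?sqrtr_ge0.
rewrite setCI setCK; apply: le_trans (measureU2 _ _ _) _ => //.
  exact: measurableC.
exact: leeD.
Qed.

Lemma sparse_error_supported w j : same_support M pihat w ->
  supported (J (pistar M j)) (pihat_vec pihat w j - pistar M j).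
Proof.
move=> /(_ j) hJ l lJ; have : l \notin J (pihat_vec pihat w j) by rewrite hJ.
move: lJ; rewrite !inE !negbK mxsubE => /eqP -> /eqP ->.
by rewrite subrr.
Qed.

(** The estimation error is supported on [J (pistar M j)], which does not depend on
the sample, so the union bound runs over the grid points of that support. *)
Lemma l2_shift_event (S rho : R) : (0 < k1)%N ->
  0 < S -> sigma_Z ^+ 2 <= S -> 0 <= rho ->
  exists E : set T, [/\ measurable E,
    forall w, E w -> shift_le w (Num.sqrt (sqr_bound S) * (4 * rho)) &
    (P (~` E) <= P (~` [set w | (max_error M pihat (@l2norm R d) w <= rho)%R]) +
       P (~` same_support M pihat) +
       (p%:R * d%:R * expR (- n%:R) + p%:R * (k1.*2.+1%:R ^+ k1 * expR (- n%:R)))%:E)%E].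
Proof.
move=> k10 S0 sS rho0; have [F [mF PF hF]] := column_event S0 sS.
set G := [set w | max_error M pihat (@l2norm R d) w <= rho].
have mG : measurable G by apply: max_error_measurable; exact: l2norm_measurable.
have mH := same_support_measurable M pihat.
pose N j (f : {ffun {l | l \in J (pistar M j)} -> 'I_(k1.*2.+1)}) :=
  [set w | n%:R * sqr_bound S * sqnorm ((grid_point R f)^~ 0) <
    sqnorm (fun i => (Zmx M w j *m grid_point R f) i 0)].
have mN j f : measurable (@N j f).
  by apply: measurable_lt_set => //; exact: sub_gaussian_mx_sqnorm_measurable (A_Z hA j).
pose N' j := [set w | exists f, @N j f w].
have mN' j : measurable (N' j) by exact: measurable_exists.
have PN' j : (P (N' j) <= (k1.*2.+1%:R ^+ k1 * expR (- n%:R))%:E)%E.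
  apply: le_trans (union_bound (mN j) (fun f =>
    sub_gaussian_mx_sqr_tail (A_Z hA j) sS S0 (grid_point R f))) _.
  rewrite lee_fin ler_wpM2r ?expR_ge0 // card_ffun card_ord card_sig -natrX ler_nat.
  by rewrite leq_pexp2l //; exact: A_pi_sparse hA j.
pose U := [set w | exists j, N' j w].
have mU : measurable U by exact: measurable_exists.
have PU : (P U <= (p%:R * (k1.*2.+1%:R ^+ k1 * expR (- n%:R)))%:E)%E.
  by have := union_bound mN' PN'; rewrite card_ord.
exists (G `&` same_support M pihat `&` ~` (F `|` U)); split.
- apply: measurableI; first exact: measurableI.
  by apply: measurableC; exact: measurableU.
- move=> w [[Gw Hw] /not_orP[Fw Uw]] j; under eq_fun do rewrite Xhat_subE.
  apply: (sqnorm_mul_sparse_le _ _ _ k10 (A_pi_sparse hA j)) => //.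
  + by move=> l; exact: hF.
  + move=> f; have /forallNP/(_ j)/forallNP/(_ f) := Uw.
    by rewrite /N /= => /negP; rewrite -leNgt sqr_sqr_bound.
  + exact: sparse_error_supported.
  have := max_error_le j Gw; rewrite /l2norm -/(sqnorm _).
  set v := _ - _; move=> h.
  have -> : sqnorm (v^~ 0) = Num.sqrt (sqnorm (v^~ 0)) ^+ 2 by rewrite sqr_sqrtr ?sqnorm_ge0.
  by rewrite ler_pXn2r ?nnegrE ?sqrtr_ge0.
rewrite !setCI setCK; apply: le_trans (measureU2 _ _ _) _.
- by apply: measurableU; exact: measurableC.
- exact: measurableU.
apply: leeD; first by apply: measureU2; exact: measurableC.
rewrite EFinD; apply: le_trans (measureU2 _ _ _) _ => //.
exact: leeD.
Qed.

End fixed_sample_size.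

(** * The failure probability in terms of the dimensions *)

Lemma max_expR_ln (R : realType) p d : (0 < p)%N ->
  expR (ln (maxn p d)%:R) = (maxn p d)%:R :> R.
Proof. by move=> p0; rewrite lnK // posrE ltr0n leq_max p0. Qed.

(** An exponent of [j.+1] logarithms absorbs a prefactor [m ^+ j] and leaves a
factor [1 / m]. *)
Lemma tail_prefactor_le (R : realType) (m : nat) (a x : R) (j : nat) :
  (0 < m)%N -> 0 <= a -> a <= m%:R ^+ j -> (j.+1)%:R * ln m%:R <= x ->
  a * expR (- x) <= m%:R^-1.
Proof.
move=> m0 a0 am hx; have mp : 0 < m%:R :> R by rewrite ltr0n.
apply: (@le_trans _ _ (m%:R ^+ j * expR (- (j.+1%:R * ln m%:R)))).
  by apply: ler_pM; rewrite ?expR_ge0 // ler_expR lerN2.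
rewrite expRN expRM_natl lnK ?posrE // exprS invfM mulrCA divff ?mulr1 //.
by rewrite expf_neq0 // gt_eqF.
Qed.

Lemma high_probability_rate_le (R : realType) (c1 c2 : R) n p d :
  (0 < p)%N -> 0 <= c1 -> 1 <= c2 ->
  c1 * expR (- (c2 * ln (maxn (maxn d p) n)%:R)) <= c1 * (maxn p d)%:R^-1.
Proof.
move=> p0 c10 c21; apply: ler_wpM2l => //.
rewrite -(max_expR_ln R d p0) -expRN ler_expR lerN2.
have h1 : ln (maxn p d)%:R <= ln (maxn (maxn d p) n)%:R :> R.
  by rewrite ler_ln ?posrE ?ltr0n ?leq_max ?p0 ?orbT // ler_nat maxnC leq_maxl.
have h0 : 0 <= ln (maxn (maxn d p) n)%:R :> R.
  by rewrite ln_ge0 // ler1n !leq_max p0 orbT.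
by apply: le_trans h1 _; rewrite ler_peMl.
Qed.

Section failure_rate.
Context (R : realType) (disp : measure_display) (T : measurableType disp)
  (P : probability T R) (n p d : nat) (M : tsem P n p d)
  (pihat : 'I_p -> 'I_d -> {RV P >-> R}) (k1 k2 : nat)
  (SigmaZ : 'I_p -> 'M[R]_d) (SigmaX : 'M[R]_p)
  (sigma_eps sigma_eta sigma_Z sigma_X : R) (phi Cmin : R).
Hypothesis hA : assumption_A M k1 k2 SigmaZ SigmaX sigma_eps sigma_eta sigma_Z sigma_X.
Hypothesis n_gt1 : (1 < n)%N.
Hypotheses (np : (n <= p)%N) (k1n : (k1 <= n)%N).
Hypotheses (phi_gt0 : 0 < phi) (phi_le1 : phi <= 1) (Cmin_gt0 : 0 < Cmin).
Let K := J (betastar M).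
Let i1 := Ordinal (ltnW n_gt1).
Hypothesis hinc : infnorm_mx (Sigma_sub M i1 (~: K)%SET K
                   *m invmx (Sigma_sub M i1 K K)) <= 1 - phi.
Hypothesis hCmin : (Cmin%:E <= lambda_min (Sigma_sub M i1 K K))%E.

Let m := maxn p d.
Let L : R := ln m%:R.

Variables (S tau : R).
Hypotheses (S0 : 0 < S) (sX : sigma_X ^+ 2 <= S) (sZ : sigma_Z ^+ 2 <= S).
Hypotheses (tau_gt0 : 0 < tau) (tauC : tau <= Cmin * phi / 16)
  (tauS : tau <= 32 * S * expsq_const R).

Let be := Num.sqrt (sqr_bound S).

Let m_gt0 : (0 < m)%N.
Proof. by rewrite leq_max (leq_trans _ np) // ltnW. Qed.

Let L_ge0 : 0 <= L.
Proof. by rewrite ln_ge0 // ler1n. Qed.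

Let pm : p%:R <= m%:R :> R.
Proof. by rewrite ler_nat leq_maxl. Qed.

Let dm : d%:R <= m%:R :> R.
Proof. by rewrite ler_nat leq_maxr. Qed.

(** The level of the Gram deviations is taken to be [t = tau / #|K|], whence the
factor [#|K| ^+ 2] against [n] in the exponent; [tau] is a constant. *)
Lemma failure_rate_of_event (E : set T) (del e : R) :
  (0 < #|K|)%N -> measurable E -> (forall w, E w -> shift_le M pihat w del) ->
  (P (~` E) <= (e * m%:R^-1)%:E)%E ->
  0 <= del -> #|K|%:R * del <= 1 -> (be *+ 2 + 1) * (#|K|%:R * del) <= tau ->
  #|K|%:R ^+ 2 * L * (3 * mul_tail_const S) <= n%:R * tau ^+ 2 ->
  3 * L <= n%:R ->
  (P (incoherence_failure M pihat phi) <= ((e + 3) * m%:R^-1)%:E)%E.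
Proof.
move=> q0 mE hE PE del0 qdel1 qdel hq h3.
have C0 := mul_tail_const_gt0 S0.
set q := #|K| in q0 qdel1 qdel hq.
have qp : 0 < q%:R :> R by rewrite ltr0n.
have q1 : 1 <= q%:R :> R by rewrite ler1n.
have be0 : 0 <= be by exact: sqrtr_ge0.
pose t := tau / q%:R.
have t_tau : t <= tau by rewrite ler_pdivrMr // ler_peMr // ltW.
have tdel : (be *+ 2 + del) * del <= t.
  rewrite /t ler_pdivlMr // -mulrA (mulrC del); apply: le_trans qdel.
  apply: ler_wpM2r; first by rewrite mulr_ge0 // ltW.
  by rewrite lerD2l; apply: le_trans qdel1; rewrite ler_peMl.
have tK : t *+ 2 * q%:R <= Cmin * phi / 8.
  have tq : t * q%:R = tau by rewrite /t divfK ?gt_eqF.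
  rewrite mulrnAl tq -mulr_natr ler_pdivlMr // -mulrA -natrM.
  by move: tauC; rewrite ler_pdivlMr.
have := incoherence_failure_prob_le hA phi_gt0 phi_le1 Cmin_gt0 hinc hCmin S0 sX
  del0 tdel (le_trans t_tau tauS) tK mE hE.
move=> h; apply: le_trans h _.
have -> : ((e + 3) * m%:R^-1)%:E = ((e * m%:R^-1)%:E + (3 * m%:R^-1)%:E)%E.
  by rewrite mulrDl EFinD.
apply: leeD => //; rewrite lee_fin.
have pge0 : 0 <= p%:R :> R by [].
have h1 : p%:R * p%:R * expR (- (n%:R * t ^+ 2 / (mul_tail_const S))) <= m%:R^-1.
  apply: (@tail_prefactor_le _ m _ _ 2%N) => //; first by rewrite expr2 ler_pM.
  rewrite -/L ler_pdivlMr //.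
  have -> : n%:R * t ^+ 2 = n%:R * tau ^+ 2 / q%:R ^+ 2.
    by rewrite /t exprMn exprVn mulrA.
  rewrite ler_pdivlMr ?exprn_gt0 //.
  have E3 : q%:R ^+ 2 * L * (3 * mul_tail_const S) = 3 * L * mul_tail_const S * q%:R ^+ 2.
    by ring.
  by move: hq; rewrite E3.
have h2 : p%:R * expR (- n%:R) <= m%:R^-1 :> R.
  apply: (@tail_prefactor_le _ m _ _ 1%N) => //.
  by apply: le_trans h3; rewrite -/L ler_wpM2r // ler_nat.
have -> : 3 * m%:R^-1 = m%:R^-1 *+ 2 + m%:R^-1 :> R by ring.
by rewrite !mulr2n mulrDr !lerD.
Qed.

Lemma column_tail_rate : 3 * L <= n%:R -> p%:R * d%:R * expR (- n%:R) <= m%:R^-1 :> R.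
Proof.
move=> h3; by apply: (@tail_prefactor_le _ m _ _ 2%N) => //; rewrite expr2 ler_pM.
Qed.

(** There are [(2 k1 + 1) ^ k1 <= m ^ (3 k1)] grid points per equation. *)
Lemma grid_tail_rate : (0 < k1)%N -> 5 * (k1%:R * L) <= n%:R ->
  p%:R * (k1.*2.+1%:R ^+ k1 * expR (- n%:R)) <= m%:R^-1 :> R.
Proof.
move=> k10 h5; rewrite mulrA; apply: (@tail_prefactor_le _ m _ _ (3 * k1).+1%N) => //.
  rewrite exprS exprM; apply: ler_pM => //.
  rewrite ler_pXn2r ?nnegrE ?exprn_ge0 // -natrX ler_nat.
  have m2 : (1 < m)%N by rewrite leq_max (leq_trans n_gt1 np).
  have km : (k1 <= m)%N by rewrite leq_max (leq_trans k1n np).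
  apply: (@leq_ltn_trans (m * m)%N); first by rewrite -mul2n leq_mul.
  by rewrite !expnS expn0 muln1 -{1}(mul1n (m * m)%N) ltn_pmul2r ?muln_gt0 ?m_gt0.
apply: le_trans h5; rewrite -/L mulrA -natrM; apply: ler_wpM2r => //.
by rewrite ler_nat (mulnDl 3 2) -addn2 leq_add2l leq_pmulr.
Qed.

Let sqrt_rate (q y A zeta rho : R) :
  0 <= q -> 0 <= y -> 0 <= A -> q ^+ 2 * y * L <= zeta * n%:R ->
  rho <= A * Num.sqrt (y * L / n%:R) -> q * rho <= A * Num.sqrt zeta.
Proof.
move=> q0 y0 A0 hz hrho; have npos : 0 < n%:R :> R by rewrite ltr0n ltnW.
apply: le_trans (ler_wpM2l q0 hrho) _; rewrite mulrCA ler_wpM2l //.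
rewrite -{1}(ger0_norm q0) -sqrtr_sqr -sqrtrM ?sqr_ge0 //.
by apply: ler_wsqrtr; rewrite mulrA ler_pdivrMr // mulrA.
Qed.

Let nonempty_case (e : R) : 0 <= e ->
  ((0 < k1)%N -> (0 < #|K|)%N ->
    (P (incoherence_failure M pihat phi) <= (e * m%:R^-1)%:E)%E) ->
  (P (incoherence_failure M pihat phi) <= (e * m%:R^-1)%:E)%E.
Proof.
move=> e0 h; have [K0|K0] := posnP #|K|.
  rewrite (_ : incoherence_failure _ _ _ = set0).
    by rewrite measure0 lee_fin mulr_ge0 // invr_ge0.
  by apply/seteqP; split => w //; exact: failure_of_empty_support.
apply: h => //; rewrite lt0n; apply/eqP => k10; move: K0.
by rewrite (support_empty_of_k1_eq0 hA Cmin_gt0 hCmin k10).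
Qed.

Variables (A zeta c1 c2 rho : R).
Hypotheses (A_ge0 : 0 <= A) (c1_ge0 : 0 <= c1) (c2_ge1 : 1 <= c2).
Hypotheses (zeta1 : zeta <= 5^-1)
  (zeta2 : zeta * (3 * mul_tail_const S) <= tau ^+ 2)
  (zeta3 : 4 * be * (A * Num.sqrt zeta) <= 1)
  (zeta4 : (be *+ 2 + 1) * (4 * be * (A * Num.sqrt zeta)) <= tau).
Hypothesis (rho_ge0 : 0 <= rho).

(* [y] is [k1 ^+ 2] or [k1]; both are at least [k1 >= 1], and [#|K| >= 1], so the
   one hypothesis on the rate dominates every other quantity. *)
Let rate_conditions (y : R) :
  (0 < #|K|)%N -> k1%:R <= y -> (0 < k1)%N ->
  k2%:R ^+ 2 * y * L <= zeta * n%:R -> rho <= A * Num.sqrt (y * L / n%:R) ->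
  [/\ #|K|%:R * rho <= A * Num.sqrt zeta,
      #|K|%:R ^+ 2 * L * (3 * mul_tail_const S) <= n%:R * tau ^+ 2,
      3 * L <= n%:R & 5 * (k1%:R * L) <= n%:R].
Proof.
move=> q0 ky k10 hz hrho.
have k11 : 1 <= k1%:R :> R by rewrite ler1n.
have y1 : 1 <= y by exact: le_trans ky.
have qk : #|K|%:R <= k2%:R :> R by rewrite ler_nat; exact: A_beta_sparse hA.
have q1 : 1 <= #|K|%:R :> R by rewrite ler1n.
have hq : #|K|%:R ^+ 2 * y * L <= zeta * n%:R.
  apply: le_trans hz; rewrite !ler_wpM2r ?(le_trans _ y1) //.
  by rewrite ler_pXn2r ?nnegrE.
have q21 : 1 <= #|K|%:R ^+ 2 :> R by rewrite exprn_ege1.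
have Ly : k1%:R * L <= zeta * n%:R.
  apply: le_trans hq; rewrite ler_wpM2r //.
  by apply: le_trans ky _; rewrite ler_peMl // (le_trans _ y1).
have Lq : #|K|%:R ^+ 2 * L <= zeta * n%:R.
  apply: le_trans hq; rewrite ler_wpM2r // ler_peMr // sqr_ge0.
have n0 : 0 <= n%:R :> R by [].
have hk : 5 * (k1%:R * L) <= n%:R.
  apply: (@le_trans _ _ (5 * (zeta * n%:R))); first by rewrite ler_wpM2l.
  rewrite mulrA ler_piMl //.
  by rewrite mulrC -ler_pdivlMr // mul1r.
split => //.
- exact: (sqrt_rate _ (le_trans ler01 y1) A_ge0 hq hrho).
- have H0 : 0 <= 3 * mul_tail_const S by rewrite mulr_ge0 // ltW // mul_tail_const_gt0.
  apply: le_trans (ler_wpM2r H0 Lq) _.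
  by rewrite mulrAC mulrC ler_wpM2l.
- apply: le_trans hk; rewrite mulrA -natrM; apply: ler_wpM2r => //.
  by rewrite ler_nat (leq_trans _ (leq_pmulr 5 k10)).
Qed.

Lemma l1_failure_rate :
  high_probability P n p d c1 c2
    [set w | max_error M pihat (@l1norm R d) w <= rho] ->
  k2%:R ^+ 2 * k1%:R ^+ 2 * L <= zeta * n%:R ->
  rho <= A * Num.sqrt (k1%:R ^+ 2 * L / n%:R) ->
  (P (incoherence_failure M pihat phi) <= ((c1 + 5) * m%:R^-1)%:E)%E.
Proof.
move=> hE hz hrho; apply: nonempty_case => [|k10 K0]; first by rewrite addr_ge0.
have ky : k1%:R <= k1%:R ^+ 2 :> R by rewrite -natrX ler_nat -mulnn leq_pmulr.
have [qrho hq h3 h5] := rate_conditions K0 ky k10 hz hrho.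
have [E [mE shE PE]] := l1_shift_event pihat hA S0 sZ rho_ge0.
have be0 : 0 <= be by exact: sqrtr_ge0.
have hb : #|K|%:R * (be * rho) <= 4 * be * (A * Num.sqrt zeta).
  rewrite mulrCA -mulrA; have h := ler_wpM2l be0 qrho.
  by apply: le_trans h _; rewrite ler_peMl ?mulr_ge0 ?sqrtr_ge0 // ler1n.
have -> : c1 + 5 = (c1 + 2) + 3 by ring.
apply: (failure_rate_of_event K0 mE shE) => //.
- apply: le_trans PE _; rewrite mulrDl EFinD; apply: leeD.
    apply: le_trans (high_probability_setC _ hE) _.
      by apply: max_error_measurable; exact: l1norm_measurable.
    by rewrite lee_fin; apply: high_probability_rate_le => //; rewrite (leq_trans _ np) // ltnW.
  rewrite lee_fin; apply: le_trans (column_tail_rate h3) _.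
  by rewrite ler_peMl ?invr_ge0 // ler1n.
- exact: mulr_ge0.
- exact: le_trans zeta3.
- apply: le_trans zeta4; apply: ler_wpM2l => //.
  by rewrite addr_ge0 // mulrn_wge0.
Qed.

Lemma l2_failure_rate :
  high_probability P n p d c1 c2
    [set w | max_error M pihat (@l2norm R d) w <= rho] ->
  high_probability P n p d c1 c2 (same_support M pihat) ->
  k2%:R ^+ 2 * k1%:R * L <= zeta * n%:R ->
  rho <= A * Num.sqrt (k1%:R * L / n%:R) ->
  (P (incoherence_failure M pihat phi) <= ((c1 *+ 2 + 5) * m%:R^-1)%:E)%E.
Proof.
move=> hE hE' hz hrho; apply: nonempty_case => [|k10 K0].
  by rewrite addr_ge0 // mulrn_wge0.
have [qrho hq h3 h5] := rate_conditions K0 (lexx _) k10 hz hrho.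
have [E [mE shE PE]] := l2_shift_event pihat hA k10 S0 sZ rho_ge0.
have be0 : 0 <= be by exact: sqrtr_ge0.
have p0 : (0 < p)%N by rewrite (leq_trans _ np) // ltnW.
have hb : #|K|%:R * (be * (4 * rho)) <= 4 * be * (A * Num.sqrt zeta).
  have -> : #|K|%:R * (be * (4 * rho)) = 4 * be * (#|K|%:R * rho) by ring.
  by rewrite ler_wpM2l // mulr_ge0.
have -> : c1 *+ 2 + 5 = (c1 + c1 + 2) + 3 by ring.
apply: (failure_rate_of_event K0 mE shE) => //.
- apply: le_trans PE _; rewrite 2!mulrDl !EFinD; apply: leeD.
    apply: leeD.
      apply: le_trans (high_probability_setC _ hE) _.
        by apply: max_error_measurable; exact: l2norm_measurable.
      by rewrite lee_fin; exact: high_probability_rate_le.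
    apply: le_trans (high_probability_setC _ hE') _; first exact: same_support_measurable.
    by rewrite lee_fin; exact: high_probability_rate_le.
  rewrite -EFinD lee_fin.
  by rewrite (mulr_natl m%:R^-1) mulr2n; apply: lerD; [exact: column_tail_rate|exact: grid_tail_rate].
- by rewrite mulr_ge0 // mulr_ge0.
- exact: le_trans zeta3.
- apply: le_trans zeta4; apply: ler_wpM2l => //.
  by rewrite addr_ge0 // mulrn_wge0.
Qed.

End failure_rate.

(** * Growing sample size *)

Lemma inv_fine_le (R : realType) (a : R) (x : \bar R) :
  0 < a -> (a%:E <= x)%E -> 0 <= (fine x)^-1 <= a^-1.
Proof.
move=> a0; case: x => [r| |] /=; last by rewrite leeNy_eq.
  rewrite lee_fin => ar; have r0 : 0 < r by exact: lt_le_trans ar.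
  by rewrite invr_ge0 (ltW r0) /= lef_pV2 ?posrE.
by move=> _; rewrite invr0 lexx /= invr_ge0 ltW.
Qed.

(** How small the vanishing quantity of the rate condition has to be: [be] bounds
the column norms, [A] is the constant of the first-stage error and [tau] the
admissible deviation. *)
Lemma rate_const_exists (R : realType) (be A D tau : R) :
  0 <= be -> 0 <= A -> 0 < D -> 0 < tau ->
  exists zeta : R, [/\ 0 < zeta, zeta <= 5^-1, zeta * D <= tau ^+ 2,
    4 * be * (A * Num.sqrt zeta) <= 1 &
    (be *+ 2 + 1) * (4 * be * (A * Num.sqrt zeta)) <= tau].
Proof.
move=> be0 A0 D0 tau0.
have b0 : 0 < be *+ 2 + 1 by rewrite ltr_wpDl // mulrn_wge0.
have G0 : 0 < 4 * be * A + 1 by rewrite ltr_wpDl // !mulr_ge0.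
pose eta := Num.min 1 (tau / (be *+ 2 + 1)).
have eta0 : 0 < eta by rewrite lt_min ltr01 divr_gt0.
pose zeta := Num.min 5^-1 (Num.min (tau ^+ 2 / D) ((eta / (4 * be * A + 1)) ^+ 2)).
have z1 : zeta <= 5^-1 by rewrite ge_min lexx.
have z2 : zeta <= tau ^+ 2 / D by rewrite !ge_min lexx !orbT.
have z3 : zeta <= (eta / (4 * be * A + 1)) ^+ 2 by rewrite !ge_min lexx !orbT.
have z0 : 0 < zeta.
  by rewrite !lt_min invr_gt0 ltr0n divr_gt0 ?exprn_gt0 // divr_gt0.
have key : 4 * be * (A * Num.sqrt zeta) <= eta.
  have hs : Num.sqrt zeta <= eta / (4 * be * A + 1).
    have e0 : 0 <= eta / (4 * be * A + 1) by rewrite divr_ge0 // ltW.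
    by rewrite -[leRHS](ger0_norm e0) -sqrtr_sqr; exact: ler_wsqrtr.
  rewrite mulrA; apply: (@le_trans _ _ ((4 * be * A + 1) * Num.sqrt zeta)).
    by rewrite ler_wpM2r ?sqrtr_ge0 // lerDl.
  by rewrite mulrC -ler_pdivlMr.
exists zeta; split => //.
- by rewrite -ler_pdivlMr.
- by apply: le_trans key _; rewrite ge_min lexx.
- rewrite mulrC -ler_pdivlMr //; apply: le_trans key _.
  by rewrite ge_min lexx orbT.
Qed.

Lemma littleo1_near (R : realType) (f : nat -> R) : f =o_\oo (fun=> 1 : R) ->
  forall e, 0 < e -> \forall n \near \oo, f n <= e.
Proof.
move=> /eqoP fo e e0; near=> n.
have : `|f n| <= e * `|1 : R| by near: n; exact: fo.
by rewrite normr1 mulr1; apply: le_trans; exact: ler_norm.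
Unshelve. all: by end_near. Qed.

Lemma littleo_nat_near_le (R : realType) (k : nat -> nat) :
  (fun n => (k n)%:R : R) =o_\oo (fun n => n%:R : R) ->
  \forall n \near \oo, (k n <= n)%N.
Proof.
move=> /eqoP ko; near=> n.
have : `|(k n)%:R| <= 1 * `|n%:R : R| by near: n; exact: ko.
by rewrite mul1r !normr_nat ler_nat.
Unshelve. all: by end_near. Qed.

Lemma bigO_of_near_le (R : realType) (f g : nat -> R) (c : R) : 0 < c ->
  (\forall n \near \oo, 0 <= f n <= c * g n) -> f =O_\oo g.
Proof.
move=> c0 h; apply/eqO_exP; exists c => //; near=> n.
have /andP[f0 fg] : 0 <= f n <= c * g n by near: n.
rewrite ger0_norm //; apply: le_trans fg _.
by rewrite ler_wpM2l ?ler_norm // ltW.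
Unshelve. all: by end_near. Qed.

(** The argument gives the stronger rate [1 / maxn p d]. *)
Lemma probability_rate_bigO (R : realType) (disp : nat -> measure_display)
    (T : forall n, measurableType (disp n)) (P : forall n, probability (T n) R)
    (E : forall n, set (T n)) (p d : nat -> nat) (c : R) :
  0 < c -> (forall n, (n <= p n)%N) -> (forall n, (n <= d n)%N) ->
  (\forall n \near \oo, (P n (E n) <= (c * (maxn (p n) (d n))%:R^-1)%:E)%E) ->
  (fun n => fine (P n (E n))) =O_\oo (fun n => (minn (p n) (d n))%:R^-1 : R).
Proof.
move=> c0 hp hd h; apply: (bigO_of_near_le c0); near=> n.
have n0 : (0 < n)%N by near: n; exists 1%N.
have hn : (P n (E n) <= (c * (maxn (p n) (d n))%:R^-1)%:E)%E by near: n.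
have Pge0 : (0 <= P n (E n))%E by [].
rewrite fine_ge0 //=.
have : (fine (P n (E n)) <= c * (maxn (p n) (d n))%:R^-1)%R.
  move: hn Pge0; case: (P n (E n)) => //= r; by rewrite lee_fin.
move=> /le_trans; apply; rewrite ler_wpM2l ?(ltW c0) //.
have m0 : (0 < minn (p n) (d n))%N.
  by rewrite leq_min (leq_trans n0 (hp n)) (leq_trans n0 (hd n)).
have m1 : (minn (p n) (d n) <= maxn (p n) (d n))%N.
  exact: leq_trans (geq_minl _ _) (leq_maxl _ _).
by rewrite lef_pV2 ?posrE ?ltr0n // ?ler_nat // (leq_trans m0).
Unshelve. all: by end_near. Qed.

Theorem lemma6p5 (R : realType)
    (disp : nat -> measure_display) (T : forall n, measurableType (disp n))
    (P : forall n, probability (T n) R)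
    (p d k1 k2 : nat -> nat)
    (M : forall n, tsem (P n) n (p n) (d n))
    (pihat : forall n, 'I_(p n) -> 'I_(d n) -> {RV (P n) >-> R})
    (SigmaZ : forall n, 'I_(p n) -> 'M[R]_(d n))
    (SigmaX : forall n, 'M[R]_(p n))
    (sigma_eps sigma_eta sigma_Z sigma_X sigma_W : R)
    (phi Cmin lambda_Z : R)
    (sigma_eps_ge0 : 0 <= sigma_eps) (sigma_eta_ge0 : 0 <= sigma_eta)
    (sigma_Z_ge0 : 0 <= sigma_Z) (sigma_X_ge0 : 0 <= sigma_X)
    (sigma_W_ge0 : 0 <= sigma_W)
    (phi_gt0 : 0 < phi) (phi_le1 : phi <= 1) (Cmin_gt0 : 0 < Cmin)
    (lambda_Z_gt0 : 0 < lambda_Z)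
    (p_ge_n : forall n, (n <= p n)%N) (d_ge_n : forall n, (n <= d n)%N)
    (k1_slow : (fun n => (k1 n)%:R : R) =o_\oo (fun n => n%:R : R))
    (k2_slow : (fun n => (k2 n)%:R : R) =o_\oo (fun n => n%:R : R))
    (hA : forall n, (0 < n)%N ->
       assumption_A (M n) (k1 n) (k2 n) (SigmaZ n) (SigmaX n)
         sigma_eps sigma_eta sigma_Z sigma_X)
    (hlambda_Z : forall n, (0 < n)%N ->
       (lambda_Z%:E <= lambda_min_family (SigmaZ n))%E)
    (hincoherence : forall n (n_gt0 : (0 < n)%N),
       let K := J (betastar (M n)) in
       let i1 := Ordinal n_gt0 in
       infnorm_mx (Sigma_sub (M n) i1 (~: K)%SET K
                   *m invmx (Sigma_sub (M n) i1 K K)) <= 1 - phi)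
    (hCmin : forall n (n_gt0 : (0 < n)%N),
       let K := J (betastar (M n)) in
       (Cmin%:E <= lambda_min (Sigma_sub (M n) (Ordinal n_gt0) K K))%E) :
  let K1 n : R := (k1 n)%:R in
  let K2 n : R := (k2 n)%:R in
  let logp n : R := ln (p n)%:R in
  let logd n : R := ln (d n)%:R in
  let logpd n : R := ln (maxn (p n) (d n))%:R in
  let lamZ n : R := fine (lambda_min_family (SigmaZ n)) in
  let conclusion :=
    (fun n => fine (P n (incoherence_failure (M n) (@pihat n) phi)))
      =O_\oo (fun n => (minn (p n) (d n))%:R^-1 : R) in
  ((exists c c1 c2 : R, [/\ 0 < c, 0 < c1, 1 <= c2
      & forall n, (0 < n)%N ->
          high_probability (P n) n (p n) (d n) c1 c2
            [set w | max_error (M n) (@pihat n) (@l1norm R (d n)) w <=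
               c * sigma_eta / lamZ n * K1 n * Num.sqrt (logpd n / n%:R)]]) ->
   (fun n => n%:R^-1 * Num.max (K1 n * K2 n `^ (3 / 2) * logp n)
                               (K2 n ^+ 3 * logp n))
     =O_\oo (fun=> 1 : R) ->
   (fun n => n%:R^-1 * (K1 n ^+ 2 * K2 n ^+ 2 * logpd n))
     =o_\oo (fun=> 1 : R) ->
   conclusion)
  /\
  ((forall n, (0 < n)%N -> forall v : 'I_(p n) -> 'cV[R]_(d n),
      (forall j, sparse_ball (k1 n) (v j)) ->
      exists SigmaW : 'M[R]_(p n),
        sub_gaussian_mx (P n) (fun w => stack_cols (Zmx (M n) w) v)
          SigmaW (sigma_W ^+ 2)) ->
   (exists c c1 c2 : R, [/\ 0 < c, 0 < c1, 1 <= c2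
      & forall n, (0 < n)%N ->
          high_probability (P n) n (p n) (d n) c1 c2
            [set w | max_error (M n) (@pihat n) (@l2norm R (d n)) w <=
               c * sigma_eta / lamZ n * Num.sqrt (K1 n * logpd n / n%:R)] /\
          high_probability (P n) n (p n) (d n) c1 c2
            (same_support (M n) (@pihat n))]) ->
   (fun n => n%:R^-1 * Num.max (K1 n `^ (1 / 2) * K2 n `^ (3 / 2) * logp n)
                               (K2 n ^+ 3 * logp n))
     =O_\oo (fun=> 1 : R) ->
   (fun n => n%:R^-1 * Num.min (K1 n ^+ 2 * K2 n ^+ 2 * logpd n)
       (inf [set Num.max (Num.max (K1 n `^ (3 - 2 * r) * logd n)
                                  (K1 n `^ (3 - 2 * r) * logp n))
                         (Num.max (K1 n `^ r * K2 n * logd n)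
                                  (K1 n `^ r * K2 n * logp n))
             | r in [set r : R | 0 <= r <= 1]]))
     =o_\oo (fun=> 1 : R) ->
   (fun n => n%:R^-1 * (K1 n * K2 n ^+ 2 * logpd n))
     =o_\oo (fun=> 1 : R) ->
   conclusion).
Proof.
move=> K1 K2 logp logd logpd lamZ conclusion.
(* One sub-Gaussian parameter for [X*] and every [Z_j]; the summand [1] makes it
   positive. *)
pose S := sigma_X ^+ 2 + sigma_Z ^+ 2 + 1.
have S0 : 0 < S by rewrite ltr_wpDl // addr_ge0 ?sqr_ge0.
have sX : sigma_X ^+ 2 <= S by rewrite /S -addrA lerDl addr_ge0 ?sqr_ge0.
have sZ : sigma_Z ^+ 2 <= S by rewrite /S addrAC lerDr addr_ge0 ?sqr_ge0.
have C0 : 0 < expsq_const R by rewrite (lt_le_trans ltr01) // expsq_const_ge1.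
(* The first bound keeps [incoherence_stable] applicable, the second stays in the
   range of [expsq_sum_mul_tail]. *)
pose tau := Num.min (Cmin * phi / 16) (32 * S * expsq_const R).
have tau0 : 0 < tau by rewrite lt_min; apply/andP; split; rewrite !mulr_gt0 ?invr_gt0.
have tauC : tau <= Cmin * phi / 16 by rewrite ge_min lexx.
have tauS : tau <= 32 * S * expsq_const R by rewrite ge_min lexx orbT.
have D0 : 0 < 3 * mul_tail_const S by rewrite mulr_gt0 ?mul_tail_const_gt0.
have lamP n : (0 < n)%N -> 0 <= (lamZ n)^-1 <= lambda_Z^-1.
  by move=> n0; exact: inv_fine_le lambda_Z_gt0 (hlambda_Z n n0).
have large : \forall n \near \oo, (1 < n)%N by exists 2%N.
have k1_le := littleo_nat_near_le k1_slow.
split.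
- move=> [c [c1 [c2 [c_gt0 c1_gt0 c2_ge1 hE]]]] _ rate.
  have A0 : 0 <= c * sigma_eta / lambda_Z.
    by rewrite divr_ge0 ?mulr_ge0 ?(ltW c_gt0) ?(ltW lambda_Z_gt0).
  have [zeta [z0 z1 z2 z3 z4]] := rate_const_exists (sqrtr_ge0 (sqr_bound S)) A0 D0 tau0.
  have rate' := littleo1_near rate z0.
  apply: (@probability_rate_bigO R disp T P _ p d (c1 + 5)) => //; first by rewrite addr_gt0.
  near=> n.
  have n1 : (1 < n)%N by near: n.
  have n0 : (0 < n)%N by exact: ltnW.
  have k1n : (k1 n <= n)%N by near: n.
  have : n%:R^-1 * (K1 n ^+ 2 * K2 n ^+ 2 * logpd n) <= zeta by near: n.
  rewrite ler_pdivrMl ?ltr0n // => hz.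
  have /andP[l0 l1] := lamP n n0.
  have r0 : 0 <= c * sigma_eta / lamZ n * K1 n * Num.sqrt (logpd n / n%:R).
    by rewrite !mulr_ge0 ?sqrtr_ge0 // ltW.
  apply: (l1_failure_rate (pihat := @pihat n) (hA n n0) (p_ge_n n) phi_gt0 phi_le1 Cmin_gt0
    (hincoherence n (ltnW n1)) (hCmin n (ltnW n1)) S0 sX sZ tau0 tauC tauS A0
    (ltW c1_gt0) c2_ge1 z1 z2 z3 z4 r0 (hE n n0)).
    by rewrite (mulrC ((k2 n)%:R ^+ 2)) (mulrC zeta).
  have -> : Num.sqrt (K1 n ^+ 2 * logpd n / n%:R) = K1 n * Num.sqrt (logpd n / n%:R).
    by rewrite -mulrA sqrtrM ?sqr_ge0 // sqrtr_sqr ger0_norm.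
  rewrite mulrA; apply: ler_wpM2r; first exact: sqrtr_ge0.
  apply: ler_wpM2r => //; apply: ler_wpM2l => //.
  by rewrite mulr_ge0 // ltW.
- move=> _ [c [c1 [c2 [c_gt0 c1_gt0 c2_ge1 hE]]]] _ _ rate.
  have A0 : 0 <= c * sigma_eta / lambda_Z.
    by rewrite divr_ge0 ?mulr_ge0 ?(ltW c_gt0) ?(ltW lambda_Z_gt0).
  have [zeta [z0 z1 z2 z3 z4]] := rate_const_exists (sqrtr_ge0 (sqr_bound S)) A0 D0 tau0.
  have rate' := littleo1_near rate z0.
  apply: (@probability_rate_bigO R disp T P _ p d (c1 *+ 2 + 5)) => //.
    by rewrite addr_gt0 // mulrn_wgt0.
  near=> n.
  have n1 : (1 < n)%N by near: n.
  have n0 : (0 < n)%N by exact: ltnW.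
  have k1n : (k1 n <= n)%N by near: n.
  have : n%:R^-1 * (K1 n * K2 n ^+ 2 * logpd n) <= zeta by near: n.
  rewrite ler_pdivrMl ?ltr0n // => hz.
  have /andP[l0 l1] := lamP n n0.
  have [hE1 hE2] := hE n n0.
  have r0 : 0 <= c * sigma_eta / lamZ n * Num.sqrt (K1 n * logpd n / n%:R).
    by rewrite !mulr_ge0 ?sqrtr_ge0 // ltW.
  apply: (l2_failure_rate (pihat := @pihat n) (hA n n0) (p_ge_n n) k1n phi_gt0 phi_le1 Cmin_gt0
    (hincoherence n (ltnW n1)) (hCmin n (ltnW n1)) S0 sX sZ tau0 tauC tauS A0
    (ltW c1_gt0) c2_ge1 z1 z2 z3 z4 r0 hE1 hE2).
    by rewrite (mulrC ((k2 n)%:R ^+ 2)) (mulrC zeta).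
  apply: ler_wpM2r; first exact: sqrtr_ge0.
  apply: ler_wpM2l => //.
  by rewrite mulr_ge0 // ltW.
Unshelve. all: by end_near. Qed.
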